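(* Let $R$ be an integral domain, $n\ge 1$, and let $c\in M_n(R)$ be a Jordan-similar matrix. Let $S_n(c,R)=\{a\in M_n(R)\mid ac=ca\}$. (1) $S_n(c,R)$ is a cellular $R$-algebra. (2) Suppose that $R$ is a field and $c$ is of block type $\{(\lambda_{11},\lambda_{12},\dots,\lambda_{1s_1}),\dots,(\lambda_{t1},\lambda_{t2},\dots,\lambda_{ts_t})\}$. Then $S_n(c,R)$ is a quasi-hereditary algebra if and only if $\lambda_{i1}=s_i$ for all $1\le i\le t$.
   Context: A Jordan block of size $m$ with eigenvalue $r\in R$ is the $m\times m$ matrix with $r$ on the main diagonal, $1$ on the superdiagonal, and $0$ elsewhere. A Jordan-block matrix is a block diagonal matrix whose diagonal blocks are Jordan blocks. A matrix $c\in M_n(R)$ is Jordan-similar if there is $u\in GL_n(R)$ such that $ucu^{-1}$ is a Jordan-block matrix. Block type: let $a$ be a Jordan-block matrix with $t$ distinct eigenvalues $r_1,\dots,r_t$; for each $i$, let $\lambda_{i1}>\lambda_{i2}>\cdots>\lambda_{is_i}$ be the distinct sizes of the Jordan blocks of $a$ with eigenvalue $r_i$ (each size may occur several times as a block of $a$, but is listed once). The block type of $a$ is $\{(\lambda_{11},\dots,\lambda_{1s_1}),\dots,(\lambda_{t1},\dots,\lambda_{ts_t})\}$ (one tuple for each eigenvalue). The block type of a Jordan-similar matrix $c$ is that of a Jordan-block matrix to which it is similar by a matrix in $GL_n(R)$. Cellular algebra (Graham–Lehrer): let $R$ be a commutative ring with identity. A unitary $R$-algebra $A$ is cellular with cell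 datum $(P,M,C,\iota)$ if: (C1) $P$ is a finite partially ordered set, and to each $p\in P$ is associated a finite set $M(p)$ such that $\{C^p_{ij}\mid p\in P,\ i,j\in M(p)\}$ is an $R$-basis of $A$; (C2) $\iota:A\to A$ is an $R$-linear anti-automorphism with $\iota^2=\mathrm{id}$ that sends $C^p_{ij}$ to $C^p_{ji}$; (C3) for $a\in A$, $p\in P$, $i,j\in M(p)$, one has $aC^p_{ij}=\sum_{u\in M(p)}r_a(u,i)C^p_{uj}+r'$, where $r_a(u,i)\in R$ does not depend on $j$ and $r'$ is an $R$-linear combination of basis elements $C^q_{st}$ with $q$ strictly smaller than $p$. An algebra is cellular if it has some cell datum. Quasi-hereditary algebra: for a finite-dimensional algebra $A$ over a field, an ideal $I$ is a heredity ideal if $I=AeA$ for some $e=e^2\in A$ with $e\,\mathrm{rad}(A)\,e=0$ and ${}_AAeA$ projective. $A$ is quasi-hereditary if there is a chain of ideals $0=I_0\subset I_1\subset\cdots\subset I_m=A$ such that $I_i/I_{i-1}$ is a heredity ideal of $A/I_{i-1}$ for each $i$. *)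

(* Defs.v *)
From HB Require Import structures.
From mathcomp Require Import all_boot all_order all_algebra.
From mathcomp Require Import boolp classical_sets.

Set Implicit Arguments.
Unset Strict Implicit.
Unset Printing Implicit Defensive.

Import Order.TTheory GRing.Theory.

Local Open Scope ring_scope.
Local Open Scope quotient_scope.
Local Open Scope classical_set_scope.

Section Jordan.
Variable R : idomainType.

Definition jordan_block (m : nat) (r : R) : 'M[R]_m :=
  \matrix_(i, j) (r *+ (i == j) + (i.+1 == j :> nat)%:R).

(* A list of pairs (size, eigenvalue) encodes the sequence of diagonal blocks. *)
Definition jordan_mx (bs : seq (nat * R)) :=
  \mxdiag_(i < size bs)
    jordan_block (tnth (in_tuple bs) i).1 (tnth (in_tuple bs) i).2.

(* [castmx] only identifies the sum of the block sizes with [n]. *)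
Definition is_jordan_mx n (bs : seq (nat * R)) (a : 'M[R]_n) : Prop :=
  all (fun b => 0 < b.1)%N bs /\
  exists e : (\sum_(i < size bs) (tnth (in_tuple bs) i).1)%N = n,
    a = castmx (e, e) (jordan_mx bs).

Definition jordan_similar_to n (c : 'M[R]_n) (bs : seq (nat * R)) : Prop :=
  exists2 u : 'M[R]_n, u \in unitmx & is_jordan_mx bs (u *m c *m invmx u).

Definition jordan_similar n (c : 'M[R]_n) : Prop :=
  exists bs, jordan_similar_to c bs.

(* One strictly decreasing tuple of block sizes per distinct eigenvalue. *)
Definition block_type (bs : seq (nat * R)) : seq (seq nat) :=
  [seq sort geq (undup [seq b.1 | b <- bs & b.2 == r])
     | r <- undup [seq b.2 | b <- bs]].

(* A block type is an unordered family of tuples, whence [perm_eq]. *)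
Definition has_block_type n (c : 'M[R]_n) (bt : seq (seq nat)) : Prop :=
  exists2 bs, jordan_similar_to c bs & perm_eq bt (block_type bs).

End Jordan.

Section Centralizer.
Variables (R : comNzRingType) (n : nat) (c : 'M[R]_n.+1).

Definition cent_pred : {pred 'M[R]_n.+1} := fun a => comm_mxb a c.

Lemma cent_pred_subalg : subalg_closed cent_pred.
Proof.
split=> [|k a b|a b]; rewrite !unfold_in.
- by apply/eqP; rewrite mulmx1 mul1mx.
- move=> /eqP ha /eqP hb.
  by apply/eqP; rewrite mulmxDl mulmxDr -scalemxAl -scalemxAr ha hb.
- move=> /eqP ha /eqP hb.
  by apply/eqP; rewrite -mulmxA hb !mulmxA ha.
Qed.

HB.instance Definition _ :=
  GRing.isSubalgClosed.Build R 'M[R]_n.+1 cent_pred cent_pred_subalg.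

(* S_n(c, R), with n.+1 for the size so that the algebra is nontrivial. *)
Record cent_alg := CentAlg {cent_val :> 'M[R]_n.+1; _ : cent_val \in cent_pred}.

HB.instance Definition _ := [isSub for cent_val].
HB.instance Definition _ := [Choice of cent_alg by <:].
HB.instance Definition _ :=
  [SubChoice_isSubAlgebra of cent_alg by <:].

End Centralizer.

Section Cellular.
Variables (R : comPzRingType) (A : algType R).

Definition is_basis (I : finType) (b : I -> A) : Prop :=
  forall a : A, exists! f : {ffun I -> R}, a = \sum_i f i *: b i.

Record is_cell_datum (d : Order.disp_t) (P : finPOrderType d)
    (M : P -> finType) (C : forall p : P, M p -> M p -> A)
    (iota : {linear A -> A}) : Prop := {
  cell_basis : is_basis
    (fun k : {p : P & (M p * M p)%type} => C (tag k) (tagged k).1 (tagged k).2);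
  cell_iota1 : iota 1 = 1;
  cell_iotaM : forall a b, iota (a * b) = iota b * iota a;
  cell_iotaK : involutive iota;
  cell_iotaC : forall p i j, iota (C p i j) = C p j i;
  cell_mul : forall (a : A) (p : P), exists r : M p -> M p -> R,
    forall i j : M p,
    exists s : {ffun {q : P & (M q * M q)%type} -> R},
      a * C p i j = \sum_(u : M p) r u i *: C p u j
        + \sum_(k | (tag k < p)%O)
            s k *: C (tag k) (tagged k).1 (tagged k).2 }.

Definition cellular : Prop :=
  exists (d : Order.disp_t) (P : finPOrderType d) (M : P -> finType)
    (C : forall p : P, M p -> M p -> A) (iota : {linear A -> A}),
    is_cell_datum C iota.

End Cellular.

(* Closure under opposites follows from closure under multiplication by -1. *)
Record ideal (A : pzRingType) := Ideal {
  ideal_set :> set A;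
  ideal0 : ideal_set 0;
  idealD : forall x y, ideal_set x -> ideal_set y -> ideal_set (x + y);
  idealMl : forall a x, ideal_set x -> ideal_set (a * x);
  idealMr : forall x a, ideal_set x -> ideal_set (x * a) }.

Section IdealTheory.
Variables (A : pzRingType) (I : ideal A).

Definition ideal_pred : {pred A} := fun x => `[< ideal_set I x >].

Lemma ideal_predP x : reflect (ideal_set I x) (x \in ideal_pred).
Proof. exact: asboolP. Qed.

Lemma ideal_pred_zmod : zmod_closed ideal_pred.
Proof.
split=> [|x y /ideal_predP Ix /ideal_predP Iy]; apply/ideal_predP.
  exact: ideal0.
by apply: idealD => //; rewrite -mulN1r; apply: idealMl.
Qed.

HB.instance Definition _ :=
  GRing.isZmodClosed.Build A ideal_pred ideal_pred_zmod.

Definition quot_ring : Type := @Quotient.quot A ideal_pred.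

HB.instance Definition _ := GRing.Zmodule.on quot_ring.
HB.instance Definition _ := EqQuotient.on quot_ring.

Definition quot_pi (x : A) : quot_ring := \pi_quot_ring x.

Lemma quot_pi_eqP x y : reflect (quot_pi x = quot_pi y) (x - y \in ideal_pred).
Proof. by rewrite Quotient.idealrBE; exact: eqP. Qed.

Lemma quot_pi_surj (x : quot_ring) : exists a, quot_pi a = x.
Proof. by exists (repr x); exact: reprK. Qed.

Lemma quot_pi0 : quot_pi 0 = 0.
Proof. by rewrite /quot_pi raddf0. Qed.

Lemma quot_piD : {morph quot_pi : x y / x + y}.
Proof. exact: Quotient.pi_add. Qed.

Definition quot_one : quot_ring := quot_pi 1.
Definition quot_mul (x y : quot_ring) : quot_ring := quot_pi (repr x * repr y).

Lemma quot_mul_pi x y : quot_mul (quot_pi x) (quot_pi y) = quot_pi (x * y).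
Proof.
apply/quot_pi_eqP; set x' := repr _; set y' := repr _.
have /quot_pi_eqP/ideal_predP hx : quot_pi x' = quot_pi x by exact: reprK.
have /quot_pi_eqP/ideal_predP hy : quot_pi y' = quot_pi y by exact: reprK.
rewrite -(subrKA (x' * y)) -mulrBr -mulrBl; apply/ideal_predP.
by apply: idealD; [exact: idealMl | exact: idealMr].
Qed.

Lemma quot_mulA : associative quot_mul.
Proof.
move=> x y z; have [a <-] := quot_pi_surj x; have [b <-] := quot_pi_surj y.
by have [c <-] := quot_pi_surj z; rewrite !quot_mul_pi mulrA.
Qed.

Lemma quot_mul1l : left_id quot_one quot_mul.
Proof. by move=> x; have [a <-] := quot_pi_surj x; rewrite quot_mul_pi mul1r. Qed.

Lemma quot_mul1r : right_id quot_one quot_mul.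
Proof. by move=> x; have [a <-] := quot_pi_surj x; rewrite quot_mul_pi mulr1. Qed.

Lemma quot_mulDl : left_distributive quot_mul +%R.
Proof.
move=> x y z; have [a <-] := quot_pi_surj x; have [b <-] := quot_pi_surj y.
by have [c <-] := quot_pi_surj z; rewrite -quot_piD !quot_mul_pi mulrDl quot_piD.
Qed.

Lemma quot_mulDr : right_distributive quot_mul +%R.
Proof.
move=> x y z; have [a <-] := quot_pi_surj x; have [b <-] := quot_pi_surj y.
by have [c <-] := quot_pi_surj z; rewrite -quot_piD !quot_mul_pi mulrDr quot_piD.
Qed.

HB.instance Definition _ := GRing.Zmodule_isPzRing.Build quot_ring
  quot_mulA quot_mul1l quot_mul1r quot_mulDl quot_mulDr.

Lemma quot_piM : {morph quot_pi : x y / x * y}.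
Proof. by move=> x y; rewrite -quot_mul_pi. Qed.

Lemma ideal_pred_submod : submod_closed (ideal_pred : {pred A^o}).
Proof.
split=> [|a x y /ideal_predP Ix /ideal_predP Iy]; apply/ideal_predP.
  exact: ideal0.
by apply: idealD => //; exact: idealMl.
Qed.

(* Retyped over the regular module A^o, so that the subtype below is an lmodType. *)
Definition ideal_lpred : {pred A^o} := ideal_pred.

HB.instance Definition _ :=
  GRing.isSubmodClosed.Build A A^o ideal_lpred ideal_pred_submod.

Record ideal_lmod :=
  IdealLmod {ideal_val :> A^o; _ : ideal_val \in ideal_lpred}.

HB.instance Definition _ := [isSub for ideal_val].
HB.instance Definition _ := [Choice of ideal_lmod by <:].
HB.instance Definition _ :=
  [SubChoice_isSubLmodule of ideal_lmod by <:].

End IdealTheory.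

Section QuotIdeal.
Variables (A : pzRingType) (I J : ideal A).

Fact quot_ideal0 : (quot_pi I @` J : set _) 0.
Proof. by exists 0; [exact: ideal0 | exact: quot_pi0]. Qed.

Fact quot_idealD (x y : quot_ring I) : (quot_pi I @` J : set _) x ->
  (quot_pi I @` J : set _) y -> (quot_pi I @` J : set _) (x + y).
Proof.
by move=> [a Ja <-] [b Jb <-]; exists (a + b); [exact: idealD|exact: quot_piD].
Qed.

Fact quot_idealMl (x y : quot_ring I) : (quot_pi I @` J : set _) y ->
  (quot_pi I @` J : set _) (x * y).
Proof.
move=> [b Jb <-]; have [a <-] := quot_pi_surj x.
by exists (a * b); [exact: idealMl|exact: quot_piM].
Qed.

Fact quot_idealMr (x y : quot_ring I) : (quot_pi I @` J : set _) x ->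
  (quot_pi I @` J : set _) (x * y).
Proof.
move=> [a Ja <-]; have [b <-] := quot_pi_surj y.
by exists (a * b); [exact: idealMr|exact: quot_piM].
Qed.

(* The image (I + J) / I of [J] in A / I, which is J / I when [I] is in [J]. *)
Definition quot_ideal : ideal (quot_ring I) :=
  Ideal quot_ideal0 quot_idealD quot_idealMl quot_idealMr.

End QuotIdeal.

Definition projective (A : pzRingType) (M : lmodType A) : Prop :=
  forall (U V : lmodType A) (g : {linear U -> V}) (f : {linear M -> V}),
    (forall v, exists u, g u = v) ->
    exists h : {linear M -> U}, forall x, g (h x) = f x.

Section JacobsonRadical.
Variable A : pzRingType.

Definition left_ideal (L : set A) : Prop :=
  [/\ L 0, forall x y, L x -> L y -> L (x + y) & forall a x, L x -> L (a * x)].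

Definition maximal_left_ideal (L : set A) : Prop :=
  [/\ left_ideal L, ~ L 1 &
      forall K, left_ideal K -> ~ K 1 -> L `<=` K -> K = L].

Definition jacobson_radical : set A :=
  \bigcap_(L in [set L | maximal_left_ideal L]) L.

End JacobsonRadical.

(* The two-sided ideal AeA consists of finite sums of products a * e * b. *)
Definition AeA (A : pzRingType) (e : A) : set A :=
  [set x | exists s : seq (A * A), x = \sum_(y <- s) y.1 * e * y.2].

Definition heredity_ideal (A : pzRingType) (I : ideal A) : Prop :=
  exists e : A, [/\ e * e = e, I = AeA e :> set A,
    forall x, jacobson_radical x -> e * x * e = 0
    & projective (ideal_lmod I)].

(* Ring ideals of an algebra are automatically subspaces, so the chain only
   involves the underlying ring of [A] and its quotient rings. *)
Definition quasi_hereditary (F : fieldType) (A : algType F) : Prop :=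
  (exists (d : nat) (b : 'I_d -> A), is_basis b) /\
  exists (m : nat) (I : nat -> ideal A),
    [/\ I 0%N = [set 0] :> set A, I m = setT :> set A
      & forall i, (i < m)%N ->
          (I i `<` I i.+1) /\ heredity_ideal (quot_ideal (I i) (I i.+1))].

(* Main.v *)
(** Over a domain, a matrix intertwining the Jordan blocks [a] and [b] vanishes
    unless their eigenvalues agree, and is otherwise Toeplitz. So the
    centralizer has a basis [T a b p], where [T a b p] is the partial shift of
    rank [p <= min (m a) (m b)], and [T a b p * T b c q = T a c (p + q - m b)]
    (zero if the rank is not positive). Transposition
    [T a b p <-> T b a p] and the order by rank give the cell datum.

    If the sizes for each eigenvalue have no gap, the spans of the [T a b p] with
    [p <= k] form a heredity chain, whose k-th idempotent is the sum of the
    identities of the blocks of size [k]. Conversely, let [0 = I 0 < I 1 < ...]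
    be a heredity chain and fix an eigenvalue. The nilpotent part [z] of the
    matrix on its generalized eigenspace is central, so it lies in the radical
    and [z * I i.+1] is contained in [I i]. If moreover the same block identities
    belong to [I i] and [I i.+1], these ideals agree on the eigenspace, because
    an idempotent congruent to a nilpotent element modulo an ideal lies in that
    ideal. Hence the rank on [I i] is at most the number of block sizes whose
    identities belong to [I i], and the largest size is at most the number of
    distinct sizes. *)
Require Import Defs.
From HB Require Import structures.
From mathcomp Require Import all_boot all_order all_algebra.
From mathcomp Require Import boolp classical_sets.
From mathcomp Require Import zify.

Set Implicit Arguments.
Unset Strict Implicit.
Unset Printing Implicit Defensive.

Import Order.TTheory GRing.Theory.
Local Open Scope ring_scope.

(** * Centralizer of a Jordan matrix *)

(** [p] counts the ones on a Toeplitz diagonal of block [(a, b)]. *)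
Definition valid_rank (K : eqType) (B : Type) (m : B -> nat) (ev : B -> K)
    (a b : B) (p : nat) : bool :=
  [&& ev a == ev b, (0 < p)%N, (p <= m a)%N & (p <= m b)%N].

Section Intertwiners.
Variables (R : idomainType) (k l : nat) (r s : R) (g : nat -> nat -> R).
(** Entrywise form of [J_k(r) G = G J_l(s)] for a [k] by [l] matrix [G] with entries [g i j]. *)
Hypothesis gP : forall i j, (i < k)%N -> (j < l)%N ->
  r * g i j + (if (i.+1 < k)%N then g i.+1 j else 0) =
  g i j * s + (if (0 < j)%N then g i j.-1 else 0).

(** [(r - s) * g i j] is the left neighbour minus the lower one, so zeros spread from the bottom
    left corner. *)
Lemma intertwiner_neq i j : r != s -> (i < k)%N -> (j < l)%N -> g i j = 0.
Proof.
move=> rs; have [d] := ubnP (j + (k - i)); elim: d i j => // d IH i j dE ik jl.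
have E1 : (if (i.+1 < k)%N then g i.+1 j else 0) = 0.
  by case: ifP => // ik'; apply: IH; lia.
have E2 : (if (0 < j)%N then g i j.-1 else 0) = 0.
  by case: ifP => // j0; apply: IH; lia.
have := gP ik jl; rewrite E1 E2 !addr0 [r * _]mulrC => /eqP.
by rewrite -subr_eq0 -mulrBr mulf_eq0 subr_eq0 (negPf rs) orbF => /eqP.
Qed.

Hypothesis rs : r = s.

Lemma intertwiner_eq i j : (i < k)%N -> (j < l)%N ->
  (if (i.+1 < k)%N then g i.+1 j else 0) = (if (0 < j)%N then g i j.-1 else 0).
Proof.
by move=> ik jl; have := gP ik jl; rewrite rs [g i j * s]mulrC => /addrI.
Qed.

Lemma intertwiner_shift i j :
  (i < k)%N -> (j < l)%N -> (i <= j)%N -> g i j = g 0%N (j - i)%N.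
Proof.
elim: i j => [|i IH] j ik jl ij; first by rewrite subn0.
have := intertwiner_eq (ltnW ik) jl; rewrite ik (leq_ltn_trans _ ij) // => ->.
by rewrite IH; [congr (g _ _); lia | lia..].
Qed.

(** Up and left along the diagonal lies an entry of the first column in a positive row, which is
    zero. *)
Lemma intertwiner_low i j : (i < k)%N -> (j < l)%N -> (j < i)%N -> g i j = 0.
Proof.
elim: j i => [|j IH] [|i] // ik jl ij.
  by have := intertwiner_eq (ltnW ik) jl; rewrite ik.
by have := intertwiner_eq (ltnW ik) jl; rewrite ik /= => ->; apply: IH; lia.
Qed.

(** Down and right, the diagonal meets the last row before the last column; the equation one column
    further kills that entry. *)
Lemma intertwiner_high i j :
  (i < k)%N -> (j < l)%N -> (j + k < l + i)%N -> g i j = 0.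
Proof.
have [d] := ubnP (k - i); elim: d i j => // d IH i j dE ik jl ij.
have jl' : (j.+1 < l)%N by lia.
have := intertwiner_eq ik jl' => /= <-.
by case: ifP => // ik'; apply: IH; lia.
Qed.

End Intertwiners.

Section JordanCentralizer.
Variables (R : idomainType) (N : nat) (B : finType) (m : B -> nat) (ev : B -> R).
(** A matrix index is a pair (block, position); [idx] is constrained only at positions below
    [m b]. *)
Variables (blk : 'I_N -> B) (pos : 'I_N -> nat) (idx : B -> nat -> 'I_N).
Hypothesis m_gt0 : forall b, (0 < m b)%N.
Hypothesis pos_lt : forall x, (pos x < m (blk x))%N.
Hypothesis idxK : forall x, idx (blk x) (pos x) = x.
Hypothesis blk_idx : forall b i, (i < m b)%N -> blk (idx b i) = b.
Hypothesis pos_idx : forall b i, (i < m b)%N -> pos (idx b i) = i.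
Hypothesis sum_idx : forall F : 'I_N -> R,
  \sum_x F x = \sum_b \sum_(j < m b) F (idx b j).
Variable J : 'M[R]_N.
Hypothesis JE : forall x y, J x y =
  if blk x == blk y
  then ev (blk x) *+ (pos x == pos y) + ((pos x).+1 == pos y)%:R else 0.

Notation valid := (valid_rank m ev).

Lemma eq_idx x y : (x == y) = (blk x == blk y) && (pos x == pos y).
Proof.
apply/eqP/andP => [->|[/eqP e1 /eqP e2]]; first by rewrite !eqxx.
by rewrite -(idxK x) -(idxK y) e1 e2.
Qed.

Lemma sum_delta_mul (z0 : 'I_N) (b : bool) (F : 'I_N -> R) :
  \sum_z (b && (z == z0))%:R * F z = if b then F z0 else 0.
Proof.
case: b => /=; last by rewrite big1 // => z _; rewrite mul0r.
rewrite (bigD1 z0) //= eqxx mul1r big1 ?addr0 // => z /negPf->.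
by rewrite mul0r.
Qed.

Lemma J_rowE x z : J x z = ev (blk x) * (z == x)%:R +
  (((pos x).+1 < m (blk x))%N && (z == idx (blk x) (pos x).+1))%:R.
Proof.
rewrite JE [z == x]eq_sym !eq_idx; case: eqVneq => [e|ne] /=.
  rewrite mulr_natr; congr (_ + _%:R).
  case: ltnP => [h|h] /=; last by have := pos_lt z; rewrite -e; case: eqP => //; lia.
  by rewrite blk_idx // pos_idx // e eqxx eq_sym.
rewrite mulr0; case: ltnP => //= h; rewrite ?addr0 //.
by rewrite blk_idx // eq_sym (negPf ne) addr0.
Qed.

Lemma J_colE z y : J z y = ev (blk y) * (z == y)%:R +
  ((0 < pos y)%N && (z == idx (blk y) (pos y).-1))%:R.
Proof.
rewrite JE !eq_idx; case: eqVneq => [e|ne] /=.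
  rewrite mulr_natr e; congr (_ + _%:R).
  case: posnP => [->|h] //=; have := pos_lt y => h'.
  by rewrite blk_idx ?pos_idx ?e ?eqxx /=; lia.
rewrite mulr0; case: posnP => //= h; rewrite ?addr0 // add0r.
by have := pos_lt y => h'; rewrite blk_idx ?(negPf ne) //; lia.
Qed.

Lemma mul_jordan_row (X : 'M[R]_N) x y : (J *m X) x y = ev (blk x) * X x y +
  (if ((pos x).+1 < m (blk x))%N then X (idx (blk x) (pos x).+1) y else 0).
Proof.
rewrite mxE; under eq_bigr do rewrite J_rowE mulrDl -mulrA.
rewrite big_split /= -big_distrr /= sum_delta_mul; congr (_ * _ + _).
exact: (sum_delta_mul x true (fun z => X z y)).
Qed.

Lemma mul_jordan_col (X : 'M[R]_N) x y : (X *m J) x y = X x y * ev (blk y) +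
  (if (0 < pos y)%N then X x (idx (blk y) (pos y).-1) else 0).
Proof.
rewrite mxE; under eq_bigr do rewrite J_colE mulrC mulrDl -mulrA.
rewrite big_split /= -big_distrr /= sum_delta_mul mulrC; congr (_ * _ + _).
exact: (sum_delta_mul y true (fun z => X x z)).
Qed.

(** The diagonal of rank [p] meets the first row of block [(a, b)] in column [m b - p]. *)
Definition toeplitz_coord (X : 'M[R]_N) a b p : R :=
  if valid a b p then X (idx a 0) (idx b (m b - p)) else 0.

Definition toeplitz_mx (f : B -> B -> nat -> R) : 'M[R]_N :=
  \matrix_(x, y) let p := (m (blk y) + pos x - pos y)%N in
    if valid (blk x) (blk y) p then f (blk x) (blk y) p else 0.

(** One row down and one column left both raise the rank by one; where only one of these moves
    exists, the new rank is out of range. *)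
Lemma toeplitz_mx_comm f : toeplitz_mx f *m J = J *m toeplitz_mx f.
Proof.
apply/matrixP => x y; rewrite mul_jordan_row mul_jordan_col !mxE /=.
have hx := pos_lt x; have hy := pos_lt y.
congr (_ + _).
  by case: ifP => [/andP[/eqP-> _]|_]; rewrite ?mulr0 ?mul0r // mulrC.
case: ltnP => h; case: ltnP => h'; rewrite ?mxE ?blk_idx ?pos_idx //=; try lia.
- rewrite (_ : _ + pos x - _ = m (blk y) + (pos x).+1 - pos y)%N //; lia.
- case: ifP => // /and4P[_ _]; lia.
- case: ifP => // /and4P[_ _]; lia.
Qed.

Lemma toeplitz_mxK f a b p :
  valid a b p -> toeplitz_coord (toeplitz_mx f) a b p = f a b p.
Proof.
move=> v; rewrite /toeplitz_coord v mxE /=.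
have /and4P[_ p0 pa pb] := v.
have h1 : (m b - p < m b)%N by lia.
rewrite !blk_idx // !pos_idx // addn0.
by rewrite (_ : m b - (m b - p) = p)%N ?v //; lia.
Qed.

(** For equal eigenvalues, a rank above [m b] means an entry below the diagonal and a rank above
    [m a] one covered by [intertwiner_high]; any other entry slides to the first row. *)
Lemma toeplitz_coordE X x y : X *m J = J *m X -> X x y =
  toeplitz_coord X (blk x) (blk y) (m (blk y) + pos x - pos y).
Proof.
move=> XJ; pose g i j := X (idx (blk x) i) (idx (blk y) j).
set a := blk x; set b := blk y.
have gP i j : (i < m a)%N -> (j < m b)%N ->
    ev a * g i j + (if (i.+1 < m a)%N then g i.+1 j else 0) =
    g i j * ev b + (if (0 < j)%N then g i j.-1 else 0).
  move=> ia jb; have := congr1 (fun M : 'M_N => M (idx a i) (idx b j)) XJ.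
  by rewrite mul_jordan_row mul_jordan_col !blk_idx // !pos_idx // => ->.
have hx : (pos x < m a)%N := pos_lt x; have hy : (pos y < m b)%N := pos_lt y.
have -> : X x y = g (pos x) (pos y) by rewrite /g !idxK.
rewrite /toeplitz_coord; case: ifPn => [/and4P[/eqP e h1 h2 h3]|].
  rewrite (intertwiner_shift gP) //; last by lia.
  by congr (X _ (idx _ _)); lia.
have [e v|ne _] := eqVneq (ev a) (ev b); last by rewrite (intertwiner_neq gP).
case: (ltnP (pos y) (pos x)) => h; first by rewrite (intertwiner_low gP).
rewrite (intertwiner_high gP) //; move: v.
rewrite /valid_rank e eqxx /= -[m (blk y)]/(m b); lia.
Qed.

Lemma toeplitz_coord_inj X Y : X *m J = J *m X -> Y *m J = J *m Y ->
  (forall a b p, toeplitz_coord X a b p = toeplitz_coord Y a b p) -> X = Y.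
Proof.
move=> XJ YJ e; apply/matrixP => x y.
by rewrite (toeplitz_coordE _ _ XJ) (toeplitz_coordE _ _ YJ) e.
Qed.

Lemma toeplitz_coord1 a b p :
  toeplitz_coord 1%:M a b p = ((a == b) && (p == m a))%:R.
Proof.
rewrite /toeplitz_coord mxE eq_idx /valid_rank.
have ha := m_gt0 a; have hb := m_gt0 b.
case: ifPn => [/and4P[e h1 h2 h3]|].
  rewrite !blk_idx ?pos_idx //; try lia.
  by case: eqVneq => //= ->; congr (_%:R); case: eqP => h; case: eqP => // ?; lia.
case: (eqVneq a b) => //= -> ; rewrite eqxx; case: eqP => // ->.
by rewrite leqnn hb.
Qed.

(** At position [j] of block [b] the factors have ranks [p = m b - j] and [q + j], with sum
    [q + m b]. *)
Lemma toeplitz_coordM X Y a c q : X *m J = J *m X -> Y *m J = J *m Y ->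
  (0 < q)%N -> toeplitz_coord (X *m Y) a c q =
  \sum_b \sum_(p < (m b).+1)
    toeplitz_coord X a b p * toeplitz_coord Y b c (q + m b - p)%N.
Proof.
move=> XJ YJ q0; rewrite {1}/toeplitz_coord; case: ifPn => [|v].
  move=> /and4P[e _ qa qc]; rewrite mxE sum_idx; apply: eq_bigr => b _.
  rewrite big_ord_recl [X in X * _]/toeplitz_coord [valid _ _ _]/valid_rank andbF.
  rewrite mul0r add0r.
  rewrite (reindex_inj rev_ord_inj) /=; apply: eq_bigr => j _.
  have hj := ltn_ord j.
  rewrite (toeplitz_coordE _ _ XJ) (toeplitz_coordE _ _ YJ) !blk_idx ?m_gt0 //; try lia.
  rewrite !pos_idx ?m_gt0 //; try lia.
  by rewrite /bump /=; congr (toeplitz_coord _ _ _ _ * toeplitz_coord _ _ _ _); lia.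
rewrite big1 // => b _; rewrite big1 // => p _.
rewrite /toeplitz_coord; case: ifPn => [/and4P[/eqP e1 h1 h2 h3]|]; last by rewrite mul0r.
case: ifPn => [/and4P[/eqP e2 h4 h5 h6]|]; last by rewrite mulr0.
by case/negP: v; rewrite /valid_rank e1 e2 eqxx q0 /=; lia.
Qed.

End JordanCentralizer.

(* [co x a b p] is the coefficient in [x] of the shift of rank [p] from block [b]
   to block [a]: indexing by the rank rather than by the Toeplitz diagonal
   [m b - p] makes the coordinates symmetric in [a] and [b]. *)
Record block_coords (R : comNzRingType) (A : algType R) (K : eqType)
    (B : finType) (m : B -> nat) (ev : B -> K)
    (co : A -> B -> B -> nat -> R) : Prop := BlockCoords {
  size_gt0 : forall b, (0 < m b)%N;
  coP : forall k x y a b p,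
    co (k *: x + y) a b p = k * co x a b p + co y a b p;
  co_inj : forall x y, (forall a b p, co x a b p = co y a b p) -> x = y;
  co_invalid : forall x a b p, ~~ valid_rank m ev a b p -> co x a b p = 0;
  co_surj : forall f : B -> B -> nat -> R, exists x, forall a b p,
    valid_rank m ev a b p -> co x a b p = f a b p;
  co1 : forall a b p, co 1 a b p = ((a == b) && (p == m a))%:R;
  coM : forall x y a c q, (0 < q)%N -> co (x * y) a c q =
    \sum_b \sum_(p < (m b).+1) co x a b p * co y b c (q + m b - p)%N }.

Section JordanCoords.
Variables (R : idomainType) (n : nat) (c : 'M[R]_n.+1) (bs : seq (nat * R)).

Let m (i : 'I_(size bs)) : nat := (tnth (in_tuple bs) i).1.
Let ev (i : 'I_(size bs)) : R := (tnth (in_tuple bs) i).2.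

Lemma jordan_mxE (s t : 'I_(\sum_i m i)) : jordan_mx bs s t =
  if tagnat.sig1 s == tagnat.sig1 t
  then ev (tagnat.sig1 s) *+ (tagnat.sig2 s == tagnat.sig2 t :> nat)
       + ((tagnat.sig2 s).+1 == tagnat.sig2 t :> nat)%:R
  else 0.
Proof.
rewrite /jordan_mx /mxdiag mxE.
case: eqP => [h|_]; last by rewrite mxE.
move: (tagnat.sig1 s) (tagnat.sig1 t) h (tagnat.sig2 s) (tagnat.sig2 t).
by move=> j k; case: _ / => x y; rewrite conform_mx_id mxE.
Qed.

(** Conjugation by [u] carries the centralizer of [c] onto that of a Jordan matrix, where Toeplitz
    coordinates apply. *)
Lemma centralizer_coords : jordan_similar_to c bs ->
  exists co, @block_coords R (cent_alg c) R 'I_(size bs) m ev co.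
Proof.
case=> u uU [mpos [e JE]]; set J := _ *m invmx u in JE.
pose blk (x : 'I_n.+1) := @tagnat.sig1 _ m (cast_ord (esym e) x).
pose pos (x : 'I_n.+1) : nat := @tagnat.sig2 _ m (cast_ord (esym e) x).
pose idx b i : 'I_n.+1 :=
  if insub i : option 'I_(m b) is Some j then cast_ord e (tagnat.Rank b j)
  else ord0.
have m_gt0 b : (0 < m b)%N by apply: (allP mpos); apply: mem_tnth.
have pos_lt x : (pos x < m (blk x))%N by exact: ltn_ord.
have idxK x : idx (blk x) (pos x) = x.
  by rewrite /idx valK tagnat.sig2K cast_ordKV.
have idxE b (j : 'I_(m b)) : idx b j = cast_ord e (tagnat.Rank b j).
  by rewrite /idx valK.
have blk_idx b i : (i < m b)%N -> blk (idx b i) = b.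
  by move=> h; rewrite (idxE b (Ordinal h)) /blk cast_ordK tagnat.Rank1K.
have pos_idx b i : (i < m b)%N -> pos (idx b i) = i.
  move=> h; rewrite (idxE b (Ordinal h)) /pos cast_ordK.
  exact: (congr1 val (tagnat.Rank2K (Ordinal h))).
have sum_idx (F : 'I_n.+1 -> R) :
    \sum_x F x = \sum_b \sum_(j < m b) F (idx b j).
  rewrite sig_big_dep /=.
  rewrite (reindex (fun t : {b & 'I_(m b)} => cast_ord e (tagnat.rank t))) /=.
    apply: eq_bigr => -[b j] _ /=.
    by rewrite idxE tagnat.rankE.
  exists (fun x => tagnat.sig (cast_ord (esym e) x)) => t _.
    by rewrite cast_ordK tagnat.rankK.
  by rewrite tagnat.sigK cast_ordKV.
have JE' x y : J x y = if blk x == blk y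
    then ev (blk x) *+ (pos x == pos y) + ((pos x).+1 == pos y)%:R else 0.
  by rewrite JE castmxE /= jordan_mxE.
clearbody blk pos idx.
pose conj (x : 'M[R]_n.+1) := u *m x *m invmx u.
have conjM x y : conj (x *m y) = conj x *m conj y.
  by rewrite /conj !mulmxA mulmxKV.
have conj_comm (x : cent_alg c) : conj (cent_val x) *m J = J *m conj (cent_val x).
  case: x => x /= /eqP xc; rewrite -[J]/(conj c) -!conjM.
  exact: (congr1 conj xc).
have conj_inj x y : conj x = conj y -> x = y.
  move=> /(congr1 (fun z => invmx u *m z *m u)).
  by rewrite /conj !mulmxA !(mulVmx uU) !mul1mx !mulmxKV.
exists (fun x => toeplitz_coord m ev idx (conj (cent_val x))); split=> //.
- move=> k x y a b p; rewrite /toeplitz_coord; case: ifP => _.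
    rewrite -[cent_val (_ + _)]/(k *: cent_val x + cent_val y).
    by rewrite /conj mulmxDr mulmxDl -scalemxAr -scalemxAl !mxE.
  by rewrite mulr0 addr0.
- move=> x y h; apply/val_inj/conj_inj.
  exact: (toeplitz_coord_inj pos_lt idxK blk_idx pos_idx JE' (conj_comm x) (conj_comm y)).
- by move=> x a b p /negPf h; rewrite /toeplitz_coord h.
- move=> f; pose X := toeplitz_mx m ev blk pos f.
  have XJ : X *m J = J *m X :=
    toeplitz_mx_comm pos_lt idxK blk_idx pos_idx JE' _.
  have Xc : invmx u *m X *m u \in cent_pred c.
    apply/eqP/conj_inj; rewrite (conjM _ c) (conjM c).
    have -> : conj (invmx u *m X *m u) = X.
      by rewrite /conj !mulmxA mulmxV // mul1mx mulmxK.
    exact: XJ.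
  exists (CentAlg Xc) => a b p v /=.
  rewrite /conj !mulmxA mulmxV // mul1mx mulmxK //.
  exact: toeplitz_mxK.
- move=> a b p; have -> : conj (cent_val (1 : cent_alg c)) = 1%:M.
    by rewrite -[cent_val _]/(1%:M) /conj mulmx1 mulmxV.
  exact: toeplitz_coord1.
move=> x y a b q q0.
rewrite -[cent_val (_ * _)]/(cent_val x *m cent_val y) conjM.
exact: (toeplitz_coordM m_gt0 pos_lt idxK blk_idx pos_idx sum_idx JE'
  a b (conj_comm x) (conj_comm y) q0).
Qed.

End JordanCoords.

(** * Coordinates and products *)

Section BlockAlgebra.
Variables (R : comNzRingType) (A : algType R) (K : eqType) (B : finType).
Variables (m : B -> nat) (ev : B -> K) (co : A -> B -> B -> nat -> R).
Hypothesis H : block_coords m ev co.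

Notation valid := (valid_rank m ev).

Lemma coD x y a b p : co (x + y) a b p = co x a b p + co y a b p.
Proof. by have := coP H 1 x y a b p; rewrite scale1r mul1r. Qed.

Lemma co0 a b p : co 0 a b p = 0.
Proof. by apply: (@addrI _ (co 0 a b p)); rewrite -coD !addr0. Qed.

Lemma coZ k x a b p : co (k *: x) a b p = k * co x a b p.
Proof. by have := coP H k x 0 a b p; rewrite addr0 co0 addr0. Qed.

Lemma coB x y a b p : co (x - y) a b p = co x a b p - co y a b p.
Proof. by rewrite coD -scaleN1r coZ mulN1r. Qed.

Lemma co_sum (I : Type) (r : seq I) (P : pred I) (F : I -> A) a b p :
  co (\sum_(i <- r | P i) F i) a b p = \sum_(i <- r | P i) co (F i) a b p.
Proof.
by elim/big_rec2: _ => [|i y1 y2 _ e]; rewrite ?co0 // coD e.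
Qed.

Lemma co_valid x a b p : co x a b p != 0 -> valid a b p.
Proof. by apply: contraNT => /(co_invalid H)->. Qed.

Lemma co_gt x a b p : (m a < p)%N || (m b < p)%N -> co x a b p = 0.
Proof. by move=> h; apply: (co_invalid H); rewrite /valid_rank; lia. Qed.

Lemma coM_if x y a c q : co (x * y) a c q = if (0 < q)%N then
    \sum_b \sum_(p < (m b).+1) co x a b p * co y b c (q + m b - p)%N else 0.
Proof.
case: ifP => [|/negbT q0]; first exact: (coM H).
by apply: (co_invalid H); rewrite /valid_rank (negPf q0) andbF.
Qed.

Definition of_coords (f : B -> B -> nat -> R) : A := sval (cid (co_surj H f)).

Lemma co_of_coords f a b p :
  co (of_coords f) a b p = if valid a b p then f a b p else 0.
Proof.
case: ifP => [|/negbT /(co_invalid H)-> //].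
exact: (svalP (cid (co_surj H f))).
Qed.

(** [of_coords] makes this zero for an invalid triple. *)
Definition toep a b p : A :=
  of_coords (fun a' b' p' => [&& a' == a, b' == b & p' == p]%:R).

Lemma co_toep a b p : valid a b p -> forall a' b' p',
  co (toep a b p) a' b' p' = [&& a' == a, b' == b & p' == p]%:R.
Proof.
move=> v a' b' p'; rewrite co_of_coords; case: ifPn => // v'.
by case: and3P => // -[/eqP e1 /eqP e2 /eqP e3]; move: v'; rewrite e1 e2 e3 v.
Qed.

(** The two ranks add up to [p + m b], so the partner of rank [q] has rank [p + m b - q]. *)
Lemma co_mul_toep x b c q a c' p : valid b c q -> (0 < p)%N ->
  co (x * toep b c q) a c' p = if c' == c then co x a b (p + m b - q)%N else 0.
Proof.
move=> v p0; have /and4P[_ q0 qb qc] := v; rewrite coM_if p0.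
rewrite (bigD1 b) //= [X in _ + X]big1 ?addr0; last first.
  by move=> b' /negPf ne; rewrite big1 // => i _; rewrite co_toep // ne mulr0.
case: eqP => [->|ne]; last first.
  by rewrite big1 // => i _; rewrite co_toep // (introF eqP ne) andbF mulr0.
(* For [p > q] that rank exceeds [m b], and both sides vanish. *)
case: (leqP p q) => pq; last first.
  rewrite co_gt ?big1 //; last by lia.
  move=> i _; have hi := ltn_ord i.
  by rewrite co_toep // (_ : _ == q = false) ?andbF ?mulr0 //; lia.
have h : (p + m b - q < (m b).+1)%N by lia.
rewrite (bigD1 (Ordinal h)) //= co_toep // !eqxx big1 => [|i ne].
  by rewrite (_ : _ == q) ?mulr1 ?addr0 //=; lia.
rewrite co_toep // (_ : _ == q = false) ?andbF ?mulr0 //.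
by apply: contraNF ne => /eqP e; apply/eqP/val_inj => /=; have := ltn_ord i; lia.
Qed.

Lemma co_toep_mul x a b q a' c p : valid a b q -> (0 < p)%N ->
  co (toep a b q * x) a' c p = if a' == a then co x b c (p + m b - q)%N else 0.
Proof.
move=> v p0; have /and4P[_ q0 qa qb] := v; rewrite coM_if p0.
case: eqP => [->|ne]; last first.
  rewrite big1 // => b' _; rewrite big1 // => i _.
  by rewrite co_toep // (introF eqP ne) mul0r.
rewrite (bigD1 b) //= [X in _ + X]big1 ?addr0; last first.
  by move=> b' /negPf ne; rewrite big1 // => i _; rewrite co_toep // ne andbF mul0r.
have h : (q < (m b).+1)%N by lia.
rewrite (bigD1 (Ordinal h)) //= co_toep // !eqxx mul1r big1 ?addr0 // => i ne.
rewrite co_toep // (_ : _ == q :> nat = false) ?andbF ?mul0r //.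
by apply: contraNF ne => /eqP e; apply/eqP/val_inj.
Qed.

(** In matrices, the image of [toep b c q] is spanned by the first [q] basis vectors of block [b],
    and [toep a b p] kills the first [m b - p] of that block. *)
Lemma toepM a b c p q : valid a b p -> valid b c q -> toep a b p * toep b c q =
  if (m b < p + q)%N then toep a c (p + q - m b)%N else 0.
Proof.
move=> v w; apply: (co_inj H) => a' c' r.
have /and4P[/eqP e1 p0 pa pb] := v; have /and4P[/eqP e2 q0 qb qc] := w.
case: (posnP r) => [->|r0].
  by rewrite !(co_invalid H) // /valid_rank andbF.
rewrite co_toep_mul // co_toep //; case: ltnP => h.
  rewrite co_toep; last by rewrite /valid_rank e1 e2 eqxx; lia.
  rewrite eqxx /=; case: (a' =P a) => //= _; case: (c' =P c) => //= _.
  by congr (_%:R); lia.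
rewrite co0; case: ifP => // _; rewrite (_ : _ == q = false) ?andbF //; lia.
Qed.

Lemma valid_diag a p : valid a a p = (0 < p <= m a)%N.
Proof. by rewrite /valid_rank eqxx /= andbb. Qed.

Section Basis.
(** [I] is any bijective enumeration of the valid triples: the cell indices, or an ordinal type. *)
Variables (I : finType) (k1 k2 : I -> B) (k3 : I -> nat).
Hypothesis k_valid : forall i, valid (k1 i) (k2 i) (k3 i).
Hypothesis k_inj : forall i j,
  k1 i = k1 j -> k2 i = k2 j -> k3 i = k3 j -> i = j.
Hypothesis k_surj : forall a b p, valid a b p ->
  exists i, [/\ k1 i = a, k2 i = b & k3 i = p].

Lemma co_toep_sum (f : I -> R) i :
  co (\sum_j f j *: toep (k1 j) (k2 j) (k3 j)) (k1 i) (k2 i) (k3 i) = f i.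
Proof.
rewrite co_sum (bigD1 i) //= coZ co_toep // !eqxx mulr1 big1 ?addr0 // => j ne.
rewrite coZ co_toep //.
case: and3P => [[/eqP e1 /eqP e2 /eqP e3]|_]; last by rewrite mulr0.
by rewrite (k_inj e1 e2 e3) eqxx in ne.
Qed.

Lemma toep_expand x :
  x = \sum_i co x (k1 i) (k2 i) (k3 i) *: toep (k1 i) (k2 i) (k3 i).
Proof.
apply: (co_inj H) => a b p; have [v|v] := boolP (valid a b p); last first.
  by rewrite !(co_invalid H).
by have [i [<- <- <-]] := k_surj v; rewrite co_toep_sum.
Qed.

Lemma toep_basis : is_basis (fun i => toep (k1 i) (k2 i) (k3 i)).
Proof.
move=> x; exists [ffun i => co x (k1 i) (k2 i) (k3 i)]; split.
  by rewrite {1}(toep_expand x); apply: eq_bigr => i _; rewrite ffunE.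
by move=> f ->; apply/ffunP => i; rewrite ffunE co_toep_sum.
Qed.

End Basis.

(** The cellular involution. Plain matrix transposition would not preserve the centralizer in
    general. *)
Definition swap_coords x := of_coords (fun a b p => co x b a p).

Lemma validC a b p : valid a b p = valid b a p.
Proof. by rewrite /valid_rank eq_sym [(p <= m a)%N && _]andbC. Qed.

Lemma co_swap x a b p : co (swap_coords x) a b p = co x b a p.
Proof.
by rewrite co_of_coords; case: ifPn => //; rewrite validC => /(co_invalid H)->.
Qed.

Lemma swap_coords_linear : linear swap_coords.
Proof.
by move=> k x y; apply: (co_inj H) => a b p; rewrite !(coP H, co_swap).
Qed.

HB.instance Definition _ :=
  GRing.isLinear.Build R A A *:%R swap_coords swap_coords_linear.

Lemma swap_coordsK : involutive swap_coords.
Proof. by move=> x; apply: (co_inj H) => a b p; rewrite !co_swap. Qed.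

Lemma swap_coords1 : swap_coords 1 = 1.
Proof.
apply: (co_inj H) => a b p; rewrite co_swap !(co1 H).
by congr (_%:R); rewrite eq_sym; case: eqP => // ->.
Qed.

(** The condition that the two ranks add up to [q + m b] is symmetric in the factors. *)
Lemma swap_coordsM x y :
  swap_coords (x * y) = swap_coords y * swap_coords x.
Proof.
apply: (co_inj H) => a c q; rewrite co_swap !coM_if; case: ifP => // q0.
apply: eq_bigr => b _.
(* Terms with [p < q] vanish, and [p |-> q + m b - p] permutes the others. *)
have E (F G : nat -> R) : (forall p, (m b < p)%N -> G p = 0) ->
    \sum_(p < (m b).+1) F p * G (q + m b - p)%N =
    \sum_(q <= p < (m b).+1) F p * G (q + m b - p)%N.
  move=> G0; rewrite big_geq_mkord [RHS]big_mkcond; apply: eq_bigr => p _ /=.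
  by case: leqP => // h; rewrite G0 ?mulr0 //; lia.
rewrite (E (co x c b) (co y b a)); last by move=> p h; rewrite co_gt ?h.
under [RHS]eq_bigr do rewrite !co_swap.
rewrite (E (co y b a) (co x c b)); last by move=> p h; rewrite co_gt ?h ?orbT.
rewrite big_nat_rev big_nat [RHS]big_nat; apply: eq_bigr => p /andP[h1 h2].
by rewrite mulrC; congr (co _ _ _ _ * co _ _ _ _); lia.
Qed.

End BlockAlgebra.

(** * Cellularity *)

Section CellDatum.
Variables (R : comNzRingType) (A : algType R) (K : eqType) (B : finType).
Variables (m : B -> nat) (ev : B -> K) (co : A -> B -> B -> nat -> R).
Hypothesis H : block_coords m ev co.

Notation valid := (valid_rank m ev).

(** [pick] depends only on the predicate, so blocks with one eigenvalue share a representative. *)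
Definition block_repr (a : B) : B := odflt a [pick b | ev b == ev a].

Lemma ev_block_repr a : ev (block_repr a) = ev a.
Proof. by rewrite /block_repr; case: pickP => [b /eqP|]. Qed.

Lemma block_repr_eq a b : (block_repr a == block_repr b) = (ev a == ev b).
Proof.
apply/eqP/eqP => [e|e]; first by rewrite -ev_block_repr e ev_block_repr.
rewrite /block_repr (eq_pick (Q := fun c => ev c == ev b)) => [|c]; last first.
  by rewrite e.
by case: pickP => // /(_ b); rewrite eqxx.
Qed.

Lemma block_size_bound : exists N, forall a, (m a < N)%N.
Proof.
exists (\max_a m a).+1 => a; rewrite ltnS.
by rewrite (bigD1 a) //= leq_maxl.
Qed.

Section CellBasis.
Variable N : nat.
Hypothesis mN : forall a, (m a < N)%N.

(* Cells are pairs (eigenvalue, rank), an eigenvalue being represented by the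
   index of one of its blocks. *)
Notation P := ('I_#|B| *p 'I_N)%type.

(** Empty when [p.1] represents no eigenvalue or [p.2] is 0, which lets a full product of ordinals
    serve as the poset. *)
Definition cell_blocks (p : P) : finType :=
  {a : B | [&& enum_rank (block_repr a) == p.1, (0 < p.2)%N & (p.2 <= m a)%N]}.

Definition cell_elt (p : P) (i j : cell_blocks p) : A :=
  toep H (val i) (val j) p.2.

Lemma cell_eq (p q : P) : p.1 = q.1 -> p.2 = q.2 :> nat -> p = q.
Proof.
by case: p q => [x y] [x' y'] /= -> e; congr pair; apply: val_inj.
Qed.

Notation cell_index := {p : P & (cell_blocks p * cell_blocks p)%type}.
Let k1 (k : cell_index) : B := val (tagged k).1.
Let k2 (k : cell_index) : B := val (tagged k).2.
Let k3 (k : cell_index) : nat := (tag k).2.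

Lemma cell_blocks_valid (p : P) (i j : cell_blocks p) :
  valid (val i) (val j) p.2.
Proof.
case: i => i /= /and3P[/eqP e1 h0 h1]; case: j => j /= /and3P[/eqP e2 _ h2].
rewrite /valid_rank h0 h1 h2 !andbT -block_repr_eq.
by apply/eqP/enum_rank_inj; rewrite e1.
Qed.

Lemma cell_index_valid k : valid (k1 k) (k2 k) (k3 k).
Proof. exact: cell_blocks_valid. Qed.

Lemma cell_index_tag (k : cell_index) :
  (tag k).1 = enum_rank (block_repr (k2 k)).
Proof. by case: k => p [i [j Hj]] /=; have /and3P[/eqP->] := Hj. Qed.

Lemma cell_index_inj k l :
  k1 k = k1 l -> k2 k = k2 l -> k3 k = k3 l -> k = l.
Proof.
move=> e1 e2 e3; have e : tag k = tag l.
  have : (tag k).1 = (tag l).1 by rewrite !cell_index_tag e2.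
  by move=> e; apply: cell_eq e e3.
move: e1 e2 e; rewrite /k1 /k2; clear e3.
case: k l => [p [i j]] [q [i' j']] /= e1 e2 e; case: q / e in i' j' e1 e2 *.
by rewrite (val_inj e1) (val_inj e2).
Qed.

Lemma cell_index_surj a b p : valid a b p ->
  exists k, [/\ k1 k = a, k2 k = b & k3 k = p].
Proof.
move=> /and4P[/eqP e p0 pa pb].
have pN : (p < N)%N by apply: leq_ltn_trans (mN a).
pose q : P := (enum_rank (block_repr a), Ordinal pN).
have ha : [&& enum_rank (block_repr a) == q.1, (0 < q.2)%N & (q.2 <= m a)%N].
  by rewrite eqxx p0.
have hb : [&& enum_rank (block_repr b) == q.1, (0 < q.2)%N & (q.2 <= m b)%N].
  rewrite p0 pb !andbT /q /=; apply/eqP; congr enum_rank.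
  by apply/eqP; rewrite block_repr_eq e.
by exists (existT _ q (exist _ a ha, exist _ b hb)).
Qed.

Lemma cell_elt_mul (a : A) (p : P) : exists r : cell_blocks p -> cell_blocks p -> R,
  forall i j, exists s : {ffun cell_index -> R},
  a * cell_elt i j = \sum_u r u i *: cell_elt u j
    + \sum_(k | (tag k < p)%O) s k *: cell_elt (tagged k).1 (tagged k).2.
Proof.
(* By [co_mul_toep], rank [p.2] in the product comes from rank [p.2 + m i - p.2 = m i] in [a],
   whatever [j] is. *)
exists (fun u i => co a (val u) (val i) (m (val i))) => i j.
set x := \sum_u _; pose y := a * cell_elt i j - x.
exists [ffun k => co y (k1 k) (k2 k) (k3 k)].
have -> : a * cell_elt i j = x + y by rewrite addrC subrK.
congr (_ + _).
rewrite {1}(toep_expand H cell_index_valid cell_index_inj cell_index_surj y).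
rewrite [RHS]big_mkcond /=; apply: eq_bigr => k _.
case: ifPn => [_|nlt]; first by rewrite ffunE.
(* The remainder [y] must have no coordinate at a cell that is not below [p]. *)
suff -> : co y (k1 k) (k2 k) (k3 k) = 0 by rewrite scale0r.
have /and4P[_ k0 _ _] := cell_index_valid k.
rewrite /y (coB H) co_mul_toep ?cell_blocks_valid // /x (co_sum H).
case: eqP => [e2|ne]; last first.
  rewrite big1 ?subrr // => u _; rewrite (coZ H) co_toep ?cell_blocks_valid //.
  by rewrite (introF eqP ne) andbF mulr0.
have tag1 : (tag k).1 = p.1.
  rewrite cell_index_tag e2; clear; case: j => j Hj /=.
  by have /and3P[/eqP] := Hj.
have [e3|ne] := eqVneq (k3 k) p.2; last first.
  rewrite big1 => [|u _]; last first.
    by rewrite (coZ H) co_toep ?cell_blocks_valid // (negPf ne) !andbF mulr0.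
  (* A rank above [p.2] would come from a rank above [m (val i)] in [a]. *)
  rewrite subr0; apply: (co_gt H).
  have : ~~ (k3 k < p.2)%N.
    apply: contra nlt => h; rewrite lt_neqAle; apply/andP; split.
      by apply: contra ne => /eqP; rewrite /k3 => ->.
    by rewrite leEprod tag1 lexx /= leEord ltnW.
  by move: ne; lia.
(* In the cell [p] itself, the coefficient is the one already subtracted with [x]. *)
have tagp : tag k = p.
  exact: cell_eq tag1 e3.
move: e2 e3; rewrite /k1 /k2 /k3; clear nlt k0 tag1.
case: k tagp => q [u v] /= e; case: p / e in i j x y *.
move=> e2 _; rewrite (bigD1 u) //= (coZ H) co_toep ?cell_blocks_valid //.
rewrite e2 !eqxx mulr1 addKn big1 ?addr0 ?subrr // => w ne.
rewrite (coZ H) co_toep ?cell_blocks_valid // (_ : val u == val w = false) ?mulr0 //.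
by apply/negbTE; apply: contra ne => /eqP e; apply/eqP/esym/val_inj.
Qed.

End CellBasis.

Lemma block_coords_cellular : cellular A.
Proof.
have [N mN] := block_size_bound.
exists _, ('I_#|B| *p 'I_N)%type, (@cell_blocks N), (@cell_elt N).
exists (swap_coords H : {linear A -> A}); split.
- exact: (toep_basis H (@cell_index_valid N) (@cell_index_inj N) (cell_index_surj mN)).
- exact: swap_coords1.
- exact: swap_coordsM.
- exact: swap_coordsK.
- move=> p i j; apply: (co_inj H) => a b q.
  rewrite co_swap !co_toep ?cell_blocks_valid //.
  by rewrite andbCA.
- exact: cell_elt_mul.
Qed.

Lemma block_coords_finite_basis : exists d (b : 'I_d -> A), is_basis b.
Proof.
have [N mN] := block_size_bound.
pose I : finType := {p : ('I_#|B| *p 'I_N)%type & (cell_blocks p * cell_blocks p)%type}.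
pose key (i : 'I_#|{: I}|) : I := enum_val i.
pose k1 i : B := val (tagged (key i)).1; pose k2 i : B := val (tagged (key i)).2.
pose k3 i : nat := (tag (key i)).2.
exists #|{: I}|, (fun i => toep H (k1 i) (k2 i) (k3 i)); apply: toep_basis.
- by move=> i; apply: cell_index_valid.
- by move=> i j e1 e2 e3; apply/enum_val_inj/cell_index_inj.
move=> a b p /(cell_index_surj mN)[k [e1 e2 e3]].
by exists (enum_rank k); rewrite /k1 /k2 /k3 /key enum_rankK.
Qed.

End CellDatum.

(** * The Jacobson radical *)

Section Radical.
Variable Q : pzRingType.
Local Open Scope classical_set_scope.
Implicit Types (L : set Q) (x y z a b e : Q).

Lemma exists_maximal_left_ideal L0 : left_ideal L0 -> ~ L0 1 ->
  exists2 L, maximal_left_ideal L & L0 `<=` L.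
Proof.
move=> idL0 L01.
(* Zorn's lemma also asks for a bound of the empty chain, so it is applied to
   the sets whose union with [L0] is a proper left ideal. *)
pose proper L := left_ideal (L `|` L0) /\ ~ (L `|` L0) 1.
have chainP F : F `<=` proper -> total_on F subset ->
    proper (\bigcup_(X in F) X).
  move=> Fproper Ftot; split; last first.
    by case=> // -[X FX X1]; case: (Fproper _ FX) => _; apply; left.
  case: idL0 => L00 L0D L0M; split; first by right.
    have sub X z : F X -> (X `|` L0) z -> (\bigcup_(X in F) X `|` L0) z.
      by move=> FX [Xz|]; [left; exists X|right].
    move=> x y [[X FX Xx]|Lx] [[Y FY Yy]|Ly]; last by right; apply: L0D.
    - case: (Ftot _ _ FX FY) => XY.
        have [[_ D _] _] := Fproper _ FY; apply: (sub _ _ FY).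
        by apply: D; left => //; apply: XY.
      have [[_ D _] _] := Fproper _ FX; apply: (sub _ _ FX).
      by apply: D; left => //; apply: XY.
    - have [[_ D _] _] := Fproper _ FX; apply: (sub _ _ FX).
      by apply: D; [left|right].
    - have [[_ D _] _] := Fproper _ FY; apply: (sub _ _ FY).
      by apply: D; [right|left].
  move=> a x [[X FX Xx]|Lx]; last by right; apply: L0M.
  have [[_ _ M] _] := Fproper _ FX.
  by have [Xax|] := M a x (or_introl Xx); [left; exists X|right].
have [L [[idL L1] maxL]] := Zorn_bigcup chainP.
exists (L `|` L0); last by right.
split=> // M idM M1 LM; apply: contrapT => neq.
apply: (maxL M).
  split=> [x Lx|ML]; first by apply: LM; left.
  by apply: neq; apply/seteqP; split=> // x /ML; left.
by rewrite /proper (setUidl (subset_trans (@subsetUr _ L L0) LM)).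
Qed.

(** [L + Q y] is a left ideal larger than [L], so it contains 1. *)
Lemma maximal_left_ideal_comaximal L y : maximal_left_ideal L -> ~ L y ->
  exists l b, L l /\ 1 = l + b * y.
Proof.
move=> [[L0 LD LM] L1 Lmax] Ly.
pose S := [set x | exists2 l, L l & exists b, x = l + b * y].
suff [l Ll [b e]] : S 1 by exists l, b.
apply: contrapT => S1; apply: Ly.
have <- : S = L.
  apply: Lmax => //; last first.
    by move=> l Ll; exists l => //; exists 0; rewrite mul0r addr0.
  split.
  - by exists 0 => //; exists 0; rewrite mul0r addr0.
  - move=> _ _ [l Ll [b ->]] [l' Ll' [b' ->]]; exists (l + l'); first exact: LD.
    by exists (b + b'); rewrite mulrDl addrACA.
  - move=> b _ [l Ll [b' ->]]; exists (b * l); first exact: LM.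
    by exists (b * b'); rewrite mulrDr mulrA.
by exists 0 => //; exists 1; rewrite add0r mul1r.
Qed.

(** [K = {y | y a in L}] is the whole ring or a maximal left ideal: if [y a] is outside [L], write
    [1 = l + b y a]; then [1 - a b y] lies in [K]. *)
Lemma jacobson_radicalM x a : jacobson_radical x -> jacobson_radical (x * a).
Proof.
move=> radx L maxL; have [[L0 LD LM] L1 Lmax] := maxL.
pose K := [set y | L (y * a)].
have idK : left_ideal K.
  split; rewrite /K /=; first by rewrite mul0r.
    by move=> y z Ly Lz; rewrite mulrDl; apply: LD.
  by move=> b y Ly; rewrite -mulrA; apply: LM.
have [K1|K1] := pselect (K 1).
  by rewrite -[x]mulr1 -mulrA; apply: LM.
apply: (radx K); split=> // M [M0 MD MM] M1 KM.
apply/seteqP; split=> // y My; apply: contrapT => Ky.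
have [l [b [Ll e]]] := maximal_left_ideal_comaximal maxL Ky.
have Kby : K (1 - a * b * y).
  rewrite /K /= mulrBl mul1r -!mulrA.
  have -> : a - a * (b * (y * a)) = a * l.
    by rewrite -{1}[a]mulr1 e mulrDr addrK.
  exact: LM.
by apply: M1; rewrite -(subrK (a * b * y) 1); apply: MD; [apply: KM|apply: MM].
Qed.

Lemma jacobson_radicalMl a x : jacobson_radical x -> jacobson_radical (a * x).
Proof. by move=> radx L maxL; have [[_ _ M] _ _] := maxL; apply: M; exact: radx. Qed.

(** Otherwise [1 - e] generates a proper left ideal; a maximal one above it contains [e] too, hence
    1. *)
Lemma jacobson_radical_idem e : jacobson_radical e -> e * e = e -> e = 0.
Proof.
move=> rade ee; pose L := [set x | exists b, x = b * (1 - e)].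
have be0 (b : Q) : b * (1 - e) * e = 0 by rewrite -mulrA mulrBl mul1r ee subrr mulr0.
have idL : left_ideal L.
  split; first by exists 0; rewrite mul0r.
    by move=> _ _ [b ->] [b' ->]; exists (b + b'); rewrite mulrDl.
  by move=> a _ [b ->]; exists (a * b); rewrite mulrA.
have [[b e1]|L1] := pselect (L 1); first by rewrite -[e]mul1r e1 be0.
have [M maxM LM] := exists_maximal_left_ideal idL L1.
have [[_ MD _] M1 _] := maxM; case: M1.
rewrite -(subrK e 1); apply: MD; last exact: rade.
by apply: LM; exists 1; rewrite mul1r.
Qed.

(** If [z] is outside [L], write [1 = l + b z]; then [z^j = z^j l + b z^(j+1)], and membership in
    [L] descends from [z^k = 0] to 1. *)
Lemma jacobson_radical_central_nilp z k :
  (forall x, z * x = x * z) -> z ^+ k = 0 -> jacobson_radical z.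
Proof.
move=> zC zk L maxL; have [[L0 LD LM] L1 _] := maxL.
apply: contrapT => Lz; apply: L1.
have [l [b [Ll e]]] := maximal_left_ideal_comaximal maxL Lz.
have down j : L (z ^+ j.+1) -> L (z ^+ j).
  move=> Lj; rewrite -[z ^+ j]mulr1 e mulrDr; apply: LD; first exact: LM.
  have cbz : GRing.comm (b * z) z by rewrite /GRing.comm -!mulrA zC mulrA.
  by rewrite -(commrX j cbz) -mulrA -exprS; apply: LM.
suff : L (z ^+ 0) by [].
have : L (z ^+ k) by rewrite zk.
by elim: (k) => // j IH /down.
Qed.

End Radical.

(** * Ideals, quotient rings and a projectivity criterion *)

Lemma AeA_sub (Q : pzRingType) (J : ideal Q) (e x : Q) :
  ideal_set J e -> AeA e x -> ideal_set J x.
Proof.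
move=> Je [s ->]; elim/big_rec: _ => [|y z _ Jz]; first exact: ideal0.
by apply: idealD => //; apply: Defs.idealMr; apply: idealMl.
Qed.

Lemma quot_piP (Q : pzRingType) (J : ideal Q) x y :
  quot_pi J x = quot_pi J y <-> ideal_set J (x - y).
Proof.
split=> [e|e]; first by apply/ideal_predP/quot_pi_eqP.
by apply/quot_pi_eqP/ideal_predP.
Qed.

Lemma quot_pi_eq0 (Q : pzRingType) (J : ideal Q) x :
  quot_pi J x = 0 <-> ideal_set J x.
Proof. by rewrite -quot_pi0 quot_piP subr0. Qed.

Lemma quot_pi_sum (Q : pzRingType) (J : ideal Q) (I : Type) (r : seq I)
    (P : pred I) (F : I -> Q) :
  quot_pi J (\sum_(i <- r | P i) F i) = \sum_(i <- r | P i) quot_pi J (F i).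
Proof. exact: (big_morph _ (@quot_piD _ J) (@quot_pi0 _ J)). Qed.

(** Lift each [f (e i)] to some [u i] and send [x] to the sum of the [phi i x *: u i]. *)
Lemma dual_basis_projective (Q : pzRingType) (J : ideal Q) (I : finType)
    (e : I -> Q) (phi : I -> Q -> Q) :
  (forall i, ideal_set J (e i)) ->
  (forall i x y, ideal_set J x -> ideal_set J y ->
     phi i (x + y) = phi i x + phi i y) ->
  (forall i a x, ideal_set J x -> phi i (a * x) = a * phi i x) ->
  (forall x, ideal_set J x -> x = \sum_i phi i x * e i) ->
  projective (ideal_lmod J).
Proof.
move=> Je phiD phiM phiE U V g f gsurj.
have JP (x : ideal_lmod J) : ideal_set J (ideal_val x).
  by case: x => x /= /ideal_predP.
have eP i : e i \in ideal_lpred J by apply/ideal_predP.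
have [u uE] := choice (fun i => gsurj (f (IdealLmod (eP i)))).
pose h (x : ideal_lmod J) : U := \sum_i phi i (ideal_val x) *: u i.
have hlin : linear h.
  move=> a x y; rewrite /h scaler_sumr -big_split; apply: eq_bigr => i _ /=.
  rewrite -[X in phi i X *: _ = _]/(a * ideal_val x + ideal_val y).
  rewrite phiD ?phiM ?scalerDl ?scalerA //.
  exact/idealMl/JP.
pose hL : {linear ideal_lmod J -> U} :=
  HB.pack h (GRing.isLinear.Build Q (ideal_lmod J) U *:%R h hlin).
exists hL => x /=; rewrite /h linear_sum /=.
have {2}-> : x = \sum_i (phi i (ideal_val x) : Q) *: IdealLmod (eP i).
  apply: val_inj; rewrite [LHS](phiE _ (JP x)) raddf_sum /=.
  by apply: eq_bigr => i _.
by rewrite linear_sum; apply: eq_bigr => i _; rewrite !linearZ uE.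
Qed.

(** * Block idempotents and the filtration by rank *)

Section BlockIdempotents.
Variables (R : comNzRingType) (A : algType R) (K : eqType) (B : finType).
Variables (m : B -> nat) (ev : B -> K) (co : A -> B -> B -> nat -> R).
Hypothesis H : block_coords m ev co.

Notation valid := (valid_rank m ev).

Definition block_idem (S : pred B) : A := \sum_(a | S a) toep H a a (m a).

Lemma valid_self a : valid a a (m a).
Proof. by rewrite valid_diag leqnn (size_gt0 H). Qed.

Lemma co_idem_mul S x a b p :
  co (block_idem S * x) a b p = if S a then co x a b p else 0.
Proof.
case: (posnP p) => [->|p0].
  by rewrite !(co_invalid H) ?if_same // /valid_rank andbF.
rewrite /block_idem mulr_suml (co_sum H) big_mkcond (bigD1 a) //=.
rewrite [X in _ + X]big1 ?addr0 => [|b' /negPf ne].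
  by rewrite co_toep_mul ?valid_self // eqxx addnK.
by rewrite co_toep_mul ?valid_self // eq_sym ne if_same.
Qed.

Lemma co_mul_idem S x a b p :
  co (x * block_idem S) a b p = if S b then co x a b p else 0.
Proof.
case: (posnP p) => [->|p0].
  by rewrite !(co_invalid H) ?if_same // /valid_rank andbF.
rewrite /block_idem mulr_sumr (co_sum H) big_mkcond (bigD1 b) //=.
rewrite [X in _ + X]big1 ?addr0 => [|b' /negPf ne].
  by rewrite co_mul_toep ?valid_self // eqxx addnK.
by rewrite co_mul_toep ?valid_self // eq_sym ne if_same.
Qed.

Lemma block_idemM S : block_idem S * block_idem S = block_idem S.
Proof.
apply: (co_inj H) => a b p; rewrite co_idem_mul.
by rewrite -[block_idem S]mulr1 co_idem_mul; case: (S a).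
Qed.

Definition rank_le k : set A :=
  [set x | forall a b p, (k < p)%N -> co x a b p = 0]%classic.

Lemma rank_le0 k : rank_le k 0.
Proof. by move=> a b p _; apply: (co0 H). Qed.

Lemma rank_leD k x y : rank_le k x -> rank_le k y -> rank_le k (x + y).
Proof. by move=> hx hy a b p h; rewrite (coD H) hx ?hy ?addr0. Qed.

(** Through block [c], the right factor has rank [q + m c - p >= q], since [p <= m c]. *)
Lemma rank_leMl k x y : rank_le k y -> rank_le k (x * y).
Proof.
move=> hy a b q h; rewrite (coM_if H); case: ifP => // _.
rewrite big1 // => c _; rewrite big1 // => p _; rewrite hy ?mulr0 //.
by have := ltn_ord p; lia.
Qed.

Lemma rank_leMr k x y : rank_le k x -> rank_le k (x * y).
Proof.
move=> hx a b q h; rewrite (coM_if H); case: ifP => // _.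
rewrite big1 // => c _; rewrite big1 // => p _.
case: (ltnP k p) => hp; first by rewrite hx ?mul0r.
by rewrite [co y _ _ _](co_gt H) ?mulr0 //; lia.
Qed.

Definition rank_ideal k : ideal A :=
  Ideal (@rank_le0 k) (@rank_leD k) (@rank_leMl k)
    (fun x y => @rank_leMr k x y).

End BlockIdempotents.

(** * The heredity chain by rank *)

Section HeredityChain.
Variables (F : fieldType) (A : algType F) (K : eqType) (B : finType).
Variables (m : B -> nat) (ev : B -> K) (co : A -> B -> B -> nat -> F).
Hypothesis H : block_coords m ev co.

Notation valid := (valid_rank m ev).
Notation toep := (toep H).

Section Layer.
Variables (k : nat) (sel : B -> B).
(** [sel b] is a block of size exactly [k.+1] with the eigenvalue of [b]; the absence of gaps
    provides it. *)
Hypothesis sel_ev : forall b, (k < m b)%N -> ev (sel b) = ev b.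
Hypothesis sel_size : forall b, (k < m b)%N -> m (sel b) = k.+1.

Let I0 := rank_ideal H k.
Let I1 := rank_ideal H k.+1.
Let e0 : A := block_idem H (fun a => m a == k.+1).

(** The coefficient of [toep_sel b] in a dual basis expansion of [x] modulo rank [k]: column block
    [b] is moved to [sel b] with ranks kept. *)
Definition move_to_sel b (x : A) : A := of_coords H (fun a a' p =>
  if (a' == sel b) && (k < m b)%N then co x a b p else 0).

(** Ranks up to [k.+1] fit into [sel b], so [of_coords] cuts nothing off. *)
Lemma co_move_to_sel b x a a' p : ideal_set I1 x ->
  co (move_to_sel b x) a a' p =
  if (a' == sel b) && (k < m b)%N then co x a b p else 0.
Proof.
move=> x1; rewrite co_of_coords; case: ifPn => // v.
case: andP => // -[/eqP e kb]; apply/esym/eqP; apply: contraNT v => n0.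
have /and4P[/eqP e1 p0 pa pb] := co_valid H n0.
have pk : (p <= k.+1)%N.
  by rewrite leqNgt; apply: contra n0 => /x1 ->.
by rewrite /valid_rank e sel_ev // e1 eqxx p0 pa sel_size.
Qed.

Lemma move_to_selD b x y :
  move_to_sel b (x + y) = move_to_sel b x + move_to_sel b y.
Proof.
apply: (co_inj H) => a a' p; rewrite (coD H) !co_of_coords (coD H).
by case: ifP => // _; rewrite ?addr0 //; case: ifP; rewrite ?addr0.
Qed.

Lemma move_to_selM b a x : ideal_set I1 x ->
  move_to_sel b (a * x) = a * move_to_sel b x.
Proof.
move=> x1; apply: (co_inj H) => c c' q.
rewrite co_move_to_sel; last exact: idealMl.
rewrite !(coM_if H); case: (0 < q)%N; last by rewrite if_same.
case: ifP => h.
  apply: eq_bigr => d _; apply: eq_bigr => p _.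
  by rewrite co_move_to_sel // h.
by rewrite big1 // => d _; rewrite big1 // => p _; rewrite co_move_to_sel // h mulr0.
Qed.

Lemma move_to_sel_rank b x : ideal_set I0 x -> ideal_set I0 (move_to_sel b x).
Proof.
move=> x0 a a' p kp; by rewrite co_of_coords x0 // !if_same.
Qed.

Lemma toep_sel_valid b : (k < m b)%N -> valid (sel b) b k.+1.
Proof. by move=> kb; rewrite /valid_rank sel_ev // sel_size // eqxx leqnn. Qed.

Definition toep_sel b : A := if (k < m b)%N then toep (sel b) b k.+1 else 0.

Lemma sum_move_to_sel x : ideal_set I1 x ->
  ideal_set I0 (x - \sum_b move_to_sel b x * toep_sel b).
Proof.
move=> x1 a c p kp; rewrite (coB H) (co_sum H) (bigD1 c) //=.
have p0 : (0 < p)%N by lia.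
rewrite [X in _ - (_ + X)]big1 ?addr0 => [|b ne]; last first.
  rewrite /toep_sel; case: ifP => kb; last by rewrite mulr0 (co0 H).
  by rewrite co_mul_toep ?toep_sel_valid // eq_sym (negPf ne).
rewrite /toep_sel; case: ltnP => kb; last first.
  by rewrite mulr0 (co0 H) subr0 (co_gt H) //; lia.
rewrite co_mul_toep ?toep_sel_valid // eqxx sel_size // addnK.
by rewrite co_move_to_sel // eqxx kb subrr.
Qed.

Lemma toep_sel_ideal b : ideal_set I1 (toep_sel b).
Proof.
rewrite /toep_sel; case: ifP => kb; last exact: ideal0.
move=> a c p kp; rewrite co_toep ?toep_sel_valid //.
by rewrite (_ : p == k.+1 = false) ?andbF //; lia.
Qed.

Lemma idem_toep_sel b : e0 * toep_sel b = toep_sel b.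
Proof.
rewrite /toep_sel; case: ifP => kb; last by rewrite mulr0.
apply: (co_inj H) => a c p; rewrite co_idem_mul co_toep ?toep_sel_valid //.
by case: (a =P sel b) => [->|]; rewrite ?if_same //= sel_size // eqxx.
Qed.

Lemma block_idem_layer : ideal_set I1 e0.
Proof.
move=> a b p kp; rewrite -[e0]mulr1 co_idem_mul (co1 H).
case: eqP => // h; rewrite (_ : p == _ = false) ?andbF // h; lia.
Qed.

(** A surviving coordinate is a nonzero scalar between blocks of size [k.+1]; dividing by it would
    put a nonzero idempotent in the radical. *)
Lemma layer_radical (x : quot_ring I0) : jacobson_radical x ->
  quot_pi I0 e0 * x * quot_pi I0 e0 = 0.
Proof.
have [y <-] := quot_pi_surj x; move=> rady.
rewrite -!quot_piM; apply/quot_pi_eq0 => a b p kp.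
rewrite co_mul_idem co_idem_mul; case: eqP => // mb; case: eqP => // ma.
apply/eqP/negPn/negP => n0; have /and4P[/eqP e p0 pa pb] := co_valid H n0.
have pE : p = k.+1 by lia.
have va : valid a a k.+1 by rewrite valid_diag ma leqnn.
have vba : valid b a k.+1 by rewrite /valid_rank e ma mb eqxx leqnn.
pose f := toep a a k.+1; pose s := co y a b p.
(* [f y (b -> a)] equals [s f] modulo lower rank, so [f] is in the radical. *)
have fE : quot_pi I0 (f * y * toep b a k.+1) = quot_pi I0 (s *: f).
  apply/quot_piP => c d q kq; rewrite (coB H) (coZ H) co_toep //.
  have q0 : (0 < q)%N by lia.
  rewrite co_mul_toep //; case: (d =P a) => _; last first.
    by rewrite andbF mulr0 subr0.
  rewrite mb addnK co_toep_mul // ma addnK.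
  case: (c =P a) => _ /=; last by rewrite mulr0 subrr.
  rewrite /s pE; case: (q =P k.+1) => [->|ne].
    by rewrite mulr1 subrr.
  by rewrite mulr0 subr0 (co_gt H) //; lia.
have ff : f * f = f.
  have h : (k.+1 < k.+1 + k.+1)%N by lia.
  by rewrite /f toepM // ma h addnK.
have radf : jacobson_radical (quot_pi I0 f).
  have -> : f = s^-1%:A * (s *: f) by rewrite mulr_algl scalerA mulVf ?scale1r.
  rewrite quot_piM -fE !quot_piM; apply: jacobson_radicalMl.
  by apply: jacobson_radicalM; apply: jacobson_radicalMl.
have /quot_pi_eq0 /(_ a a k.+1 (ltnSn k)) : quot_pi I0 f = 0.
  by apply: jacobson_radical_idem => //; rewrite -quot_piM ff.
by rewrite co_toep // !eqxx; apply/eqP/oner_neq0.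
Qed.

(** [move_to_sel b] preserves [I0], so it descends to the quotient. *)
Lemma layer_move_to_sel b x : quot_pi I0 (move_to_sel b (repr (quot_pi I0 x))) =
  quot_pi I0 (move_to_sel b x).
Proof.
have /quot_piP h : quot_pi I0 (repr (quot_pi I0 x)) = quot_pi I0 x by exact: reprK.
apply/quot_piP; have := move_to_sel_rank b h.
suff -> : move_to_sel b (repr (quot_pi I0 x) - x) =
  move_to_sel b (repr (quot_pi I0 x)) - move_to_sel b x by [].
by apply: (addIr (move_to_sel b x)); rewrite -move_to_selD !subrK.
Qed.

Lemma layer_expand x : ideal_set I1 x -> quot_pi I0 x =
  \sum_b quot_pi I0 (move_to_sel b x) * quot_pi I0 (toep_sel b).
Proof.
move=> x1; have /quot_piP -> := sum_move_to_sel x1.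
by rewrite quot_pi_sum; apply: eq_bigr => b _; rewrite quot_piM.
Qed.

Lemma layer_heredity : heredity_ideal (quot_ideal I0 I1).
Proof.
exists (quot_pi I0 e0); split.
- by rewrite -quot_piM block_idemM.
- apply/seteqP; split=> [_ [x x1 <-]|x].
    rewrite (layer_expand x1).
    (* [e0] fixes each [toep_sel b] on the left, so it can be inserted between the factors. *)
    exists [seq (quot_pi I0 (move_to_sel b x), quot_pi I0 (toep_sel b)) | b <- enum B].
    rewrite big_map big_enum /=; apply: eq_big => [b|b _]; first by rewrite inE.
    by rewrite -mulrA -[quot_pi I0 e0 * _]quot_piM idem_toep_sel.
  apply: AeA_sub; exists e0 => //; exact: block_idem_layer.
- exact: layer_radical.
apply: (dual_basis_projective (e := fun b => quot_pi I0 (toep_sel b))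
  (phi := fun b v => quot_pi I0 (move_to_sel b (repr v)))).
- by move=> b; exists (toep_sel b) => //; exact: toep_sel_ideal.
- move=> b _ _ [x x1 <-] [y y1 <-]; rewrite -quot_piD !layer_move_to_sel.
  by rewrite move_to_selD quot_piD.
- move=> b a _ [x x1 <-]; have [a' <-] := quot_pi_surj a.
  by rewrite -quot_piM !layer_move_to_sel move_to_selM // quot_piM.
move=> _ [x x1 <-]; rewrite {1}(layer_expand x1).
by apply: eq_bigr => b _; rewrite layer_move_to_sel.
Qed.

End Layer.
Lemma gapless_quasi_hereditary :
  (forall b k, (k < m b)%N -> exists2 a, ev a = ev b & m a = k.+1) ->
  quasi_hereditary A.
Proof.
move=> gapless; split; first exact: (block_coords_finite_basis H).
exists (\max_b m b)%N, (rank_ideal H); split.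
- apply/seteqP; split=> [x x0|_ ->]; last exact: ideal0.
  apply: (co_inj H) => a b [|p]; last by rewrite x0 // (co0 H).
  by rewrite !(co_invalid H) // /valid_rank andbF.
- apply/seteqP; split=> // x _ a b p hp; apply: (co_gt H).
  by rewrite (leq_ltn_trans _ hp) // (bigD1 a) //= leq_maxl.
move=> k kM; split.
  have [b kb] : exists b, (k < m b)%N.
    apply/existsP; apply: contraLR kM; rewrite negb_exists => /forallP h.
    by rewrite -leqNgt; apply/bigmax_leqP => b _; rewrite leqNgt.
  (* [toep b b k.+1] separates the two ideals. *)
  have v : valid b b k.+1 by rewrite valid_diag.
  split=> [x x0 a c p h|/(_ (toep b b k.+1))]; first by rewrite x0 // ltnW.
  move=> sub; have : ideal_set (rank_ideal H k) (toep b b k.+1).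
    apply: sub => a c p hp; rewrite co_toep //.
    by rewrite (_ : p == k.+1 = false) ?andbF //; lia.
  move=> /(_ b b k.+1 (ltnSn k)); rewrite co_toep // !eqxx.
  exact/eqP/oner_neq0.
have /choice[sel selP] b : exists a, (k < m b)%N -> ev a = ev b /\ m a = k.+1.
  case: (ltnP k (m b)) => [kb|_]; last by exists b.
  by have [a] := gapless b k kb; exists a.
by apply: (layer_heredity (sel := sel)) => b /selP[].
Qed.

End HeredityChain.

(** * Block sizes without gaps are necessary *)

Lemma quot_piX (Q : pzRingType) (J : ideal Q) x k :
  quot_pi J (x ^+ k) = quot_pi J x ^+ k.
Proof.
elim: k => [|k IH]; first by rewrite !expr0.
by rewrite !exprS quot_piM IH.
Qed.

Lemma idem_nilp_ideal (Q : pzRingType) (J : ideal Q) (f y : Q) k :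
  quot_pi J f * quot_pi J f = quot_pi J f -> quot_pi J f = quot_pi J y ->
  y ^+ k = 0 -> ideal_set J f.
Proof.
move=> ff fy yk; apply/quot_pi_eq0.
have fX j : quot_pi J f ^+ j.+1 = quot_pi J f.
  by elim: j => // j IH; rewrite exprS IH.
by rewrite -(fX k) fy -quot_piX exprSr yk mul0r quot_pi0.
Qed.

Lemma count_sub_lt (T : eqType) (P P' : pred T) (s : seq T) x :
  subpred P P' -> x \in s -> P' x -> ~~ P x -> (count P s < count P' s)%N.
Proof.
move=> sub /path.splitPr[s1 s2] P'x /negPf Px.
rewrite !count_cat /= Px P'x add0n addnCA add1n ltnS.
by apply: leq_add; apply: sub_count.
Qed.

Section Necessity.
Variables (F : fieldType) (A : algType F) (K : eqType) (B : finType).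
Variables (m : B -> nat) (ev : B -> K) (co : A -> B -> B -> nat -> F).
Hypothesis H : block_coords m ev co.

Notation valid := (valid_rank m ev).
Notation toep := (toep H).

(* The weight [m a + m b - 2 p] of a coordinate is additive under products, and
   it is positive off the square blocks of full rank. *)
Lemma nilpotent_of_weight y :
  (forall a b p, co y a b p != 0 -> (2 * p < m a + m b)%N) ->
  exists k, y ^+ k = 0.
Proof.
move=> wy; have [N mN] := block_size_bound m.
have wX j a b p : co (y ^+ j) a b p != 0 -> (2 * p + j <= m a + m b)%N.
  elim: j a b p => [|j IH] a c q.
    by move/(co_valid H) => /and4P[_ _ h1 h2]; lia.
  rewrite exprS => n0; rewrite leqNgt; apply: contra n0 => h.
  rewrite (coM_if H); case: ifP => // _; apply/eqP.
  rewrite big1 // => b _; rewrite big1 // => p _; have := ltn_ord p => hp.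
  case: (eqVneq (co y a b p) 0) => [->|/wy h1]; first by rewrite mul0r.
  case: (eqVneq (co (y ^+ j) b c (q + m b - p)%N) 0) => [->|/IH h2].
    by rewrite mulr0.
  by exfalso; move: h h1 h2 hp; rewrite !mulSn !mul0n !addn0; lia.
(* Every coordinate of [y ^+ j] has weight at least [j], and all weights are below [2 N]. *)
exists (N + N)%N; apply: (co_inj H) => a b p; rewrite (co0 H).
apply/eqP/negPn/negP => /wX; have := mN a; have := mN b; lia.
Qed.

Lemma toep_invalid a b p : ~~ valid a b p -> toep a b p = 0.
Proof.
move=> v; apply: (co_inj H) => a' b' p'; rewrite (co0 H) co_of_coords.
case: ifP => // v'; case: and3P => // -[/eqP e1 /eqP e2 /eqP e3].
by rewrite -e1 -e2 -e3 v' in v.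
Qed.

Section Eigenvalue.
Variable r : K.

Let eps : A := block_idem H (fun a => ev a == r).

(** On each block with eigenvalue [r] this is the shift by one; on a block of size 1 the rank is 0
    and the summand vanishes. *)
Definition nilp_part : A := \sum_(a | ev a == r) toep a a (m a).-1.
Let z := nilp_part.

Lemma co_nilp_mul x a b p :
  co (z * x) a b p = if (ev a == r) && (0 < p)%N then co x a b p.+1 else 0.
Proof.
case: (posnP p) => [->|p0]; first by rewrite (co_invalid H) ?andbF // /valid_rank andbF.
have E c : co (toep c c (m c).-1 * x) a b p = if a == c then co x a b p.+1 else 0.
  have := size_gt0 H c; case: (posnP (m c).-1) => [h0|h0] hc.
    rewrite toep_invalid ?valid_diag ?h0 // mul0r (co0 H).
    by case: (a =P c) => // ->; rewrite (co_gt H) //; lia.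
  rewrite co_toep_mul // ?valid_diag; last by lia.
  by case: (a =P c) => // ->; congr (co _ _ _ _); lia.
rewrite mulr_suml (co_sum H) big_mkcond (bigD1 a) //= E eqxx andbT.
rewrite [X in _ + X]big1 ?addr0 // => c ne.
by rewrite E [a == c]eq_sym (negPf ne) if_same.
Qed.

Lemma co_mul_nilp x a b p :
  co (x * z) a b p = if (ev b == r) && (0 < p)%N then co x a b p.+1 else 0.
Proof.
case: (posnP p) => [->|p0]; first by rewrite (co_invalid H) ?andbF // /valid_rank andbF.
have E c : co (x * toep c c (m c).-1) a b p = if b == c then co x a b p.+1 else 0.
  have := size_gt0 H c; case: (posnP (m c).-1) => [h0|h0] hc.
    rewrite toep_invalid ?valid_diag ?h0 // mulr0 (co0 H).
    by case: (b =P c) => // ->; rewrite (co_gt H) //; lia.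
  rewrite co_mul_toep // ?valid_diag; last by lia.
  by case: (b =P c) => // ->; congr (co _ _ _ _); lia.
rewrite mulr_sumr (co_sum H) big_mkcond (bigD1 b) //= E eqxx andbT.
rewrite [X in _ + X]big1 ?addr0 // => c ne.
by rewrite E [b == c]eq_sym (negPf ne) if_same.
Qed.

Lemma co_neq_ev x a b p : ev a != ev b -> co x a b p = 0.
Proof. by move=> /negPf ne; rewrite (co_invalid H) // /valid_rank ne. Qed.

Lemma nilp_central x : z * x = x * z.
Proof.
apply: (co_inj H) => a b p; rewrite co_nilp_mul co_mul_nilp.
have [->//|ne] := eqVneq (ev a) (ev b).
by rewrite co_neq_ev // !if_same.
Qed.

Lemma idem_central x : eps * x = x * eps.
Proof.
apply: (co_inj H) => a b p; rewrite co_idem_mul co_mul_idem.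
have [->//|ne] := eqVneq (ev a) (ev b).
by rewrite co_neq_ev // !if_same.
Qed.

Lemma nilp_nilpotent : exists k, z ^+ k = 0.
Proof.
apply: nilpotent_of_weight => a b p.
rewrite -[z]mulr1 co_nilp_mul; case: ifP => _; last by rewrite eqxx.
by move=> /(co_valid H) /and4P[_ _ h1 h2]; lia.
Qed.

Section Step.
Variables I J : ideal A.
Hypothesis IJ : forall x, ideal_set I x -> ideal_set J x.
Hypothesis hered : heredity_ideal (quot_ideal I J).

(** Modulo [I], [z] is central and nilpotent, hence in the radical, so [z e = e z e = 0]; and
    [J / I] is generated by [e]. *)
Lemma heredity_nilp x : ideal_set J x -> ideal_set I (z * x).
Proof.
case: hered => e [ee JE erad _] Jx; apply/quot_pi_eq0.
have zC v : quot_pi I z * v = v * quot_pi I z.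
  by have [a <-] := quot_pi_surj v; rewrite -!quot_piM nilp_central.
have ze : quot_pi I z * e = 0.
  have [k zk] := nilp_nilpotent.
  rewrite -ee mulrA zC; apply: erad.
  by apply: (jacobson_radical_central_nilp (k := k)); rewrite // -quot_piX zk quot_pi0.
have : AeA e (quot_pi I x) by rewrite -JE; exists x.
case=> s; rewrite quot_piM => ->; rewrite mulr_sumr big1 // => y _.
by rewrite !mulrA zC -[y.1 * _ * _]mulrA ze mulr0 mul0r.
Qed.

Notation one_blk a := (toep a a (m a)).

(** Subtracting a multiple of [w], moved into block [a], cancels the full-rank coefficient of the
    block identity. The difference [y] is nilpotent and congruent to that idempotent modulo [L]. *)
Lemma toep_full_ideal (L : ideal A) w a b : m a = m b -> ideal_set L w ->
  co w a b (m a) != 0 -> ideal_set L (one_blk a).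
Proof.
move=> mab Lw s0; set s := co w a b (m a) in s0.
have vb : valid b a (m a) by rewrite validC; apply: (co_valid H s0).
have va := valid_self H a.
pose y := one_blk a - s^-1 *: (one_blk a * w * toep b a (m a)).
have [k yk] : exists k, y ^+ k = 0.
  apply: nilpotent_of_weight => c d p; rewrite (coB H) (coZ H) co_toep //.
  case: (posnP p) => [->|p0 n0]; first by have := size_gt0 H c; lia.
  move: n0; rewrite co_mul_toep // co_toep_mul // -?mab ?addnK //.
  case: (d =P a) => [->|_]; last by rewrite andbF mulr0 subrr eqxx.
  case: (c =P a) => [->|_] /=; last by rewrite mulr0 subrr eqxx.
  case: (ltngtP p (m a)) => h; first by lia.
    by rewrite (co_gt H) ?h // mulr0 subrr eqxx.
  by rewrite h mulVf // subrr eqxx.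
apply: (idem_nilp_ideal _ _ yk).
  by rewrite -quot_piM toepM // -{1}[m a]addn0 ltn_add2l (size_gt0 H) addnK.
apply/quot_piP; rewrite opprB addrCA subrr addr0.
rewrite -mulr_algl; apply: idealMl; apply: Defs.idealMr; exact: idealMl.
Qed.

Lemma heredity_same_support :
  (forall a, ev a = r -> ideal_set J (one_blk a) -> ideal_set I (one_blk a)) ->
  forall x, ideal_set J x -> ideal_set I (eps * x).
Proof.
case: hered => e [ee JE erad _] same x Jx.
have [e0 e0E] := quot_pi_surj e.
have Je0 : ideal_set J e0.
  have : (quot_ideal I J : set _) e.
    by rewrite JE; exists [:: (1, 1)]; rewrite big_seq1 mul1r mulr1.
  case=> y Jy /esym; rewrite -e0E => /quot_piP h.
  by rewrite -(subrK y e0); apply: idealD => //; apply: IJ.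
(* Modulo [I], only the blocks whose identity is outside [I] contribute to [eps]. *)
pose bad a := (ev a == r) && ~~ `[< ideal_set I (one_blk a) >].
pose eb := block_idem H bad.
have epsE : quot_pi I eps = quot_pi I eb.
  apply/quot_piP.
  have -> : eps - eb = block_idem H
      (fun a => (ev a == r) && `[< ideal_set I (one_blk a) >]).
    apply: (co_inj H) => a b p; rewrite (coB H).
    rewrite -[eps]mulr1 -[eb]mulr1 -[block_idem _ _]mulr1 !co_idem_mul /bad.
    by case: (ev a == r); case: asboolP => _; rewrite /= ?subrr ?subr0.
  rewrite /block_idem; elim/big_rec: _ => [|a y /andP[_ /asboolP Ia] Iy].
    exact: ideal0.
  exact: idealD.
(* A coordinate of weight zero would put the identity of a bad block in [J], hence in [I]. *)
have [k yk] : exists k, (eb * e0 * eb) ^+ k = 0.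
  apply: nilpotent_of_weight => a b p n0.
  have /and4P[_ _ pa pb] := co_valid H n0.
  rewrite ltnNge; apply/negP => h.
  have ma : m a = p by lia.
  have mb : m b = p by lia.
  have : ideal_set J (one_blk a).
    apply: (toep_full_ideal (w := eb * e0 * eb) (b := b)); rewrite ?ma //.
    by apply: Defs.idealMr; apply: idealMl.
  move: n0; rewrite co_mul_idem co_idem_mul.
  case: (bad b); last by rewrite eqxx.
  case: ifP => [/andP[/eqP ea /asboolPn nI] _ /(same _ ea) //|_].
  by rewrite eqxx.
have Ie : quot_pi I (eps * e0) = 0.
  apply/quot_pi_eq0/(idem_nilp_ideal _ _ yk).
    have epsC : quot_pi I eps * e = e * quot_pi I eps.
      by rewrite -e0E -!quot_piM idem_central.
    rewrite !quot_piM e0E -mulrA [e * _]mulrA -epsC -mulrA ee mulrA.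
    by rewrite -quot_piM block_idemM.
  rewrite !quot_piM -epsE -!quot_piM -mulrA -idem_central mulrA.
  by rewrite block_idemM.
apply/quot_pi_eq0.
have : AeA e (quot_pi I x) by rewrite -JE; exists x.
case=> s; rewrite quot_piM => ->; rewrite mulr_sumr big1 // => y _.
have epsC : quot_pi I eps * y.1 = y.1 * quot_pi I eps.
  by have [a <-] := quot_pi_surj y.1; rewrite -!quot_piM idem_central.
by rewrite !mulrA epsC -[_ * _ * e]mulrA -e0E -quot_piM Ie mulr0 mul0r.
Qed.

End Step.
(** The identity of block [b] factors through that of block [a]. *)
Lemma full_ideal_same_size (L : ideal A) a b : ev a = ev b -> m a = m b ->
  ideal_set L (toep a a (m a)) -> ideal_set L (toep b b (m b)).
Proof.
move=> eab mab La; have v : valid b a (m a).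
  by rewrite /valid_rank eab mab eqxx leqnn (size_gt0 H).
have w : valid a b (m a) by rewrite validC.
have va := valid_self H a.
apply: (toep_full_ideal (b := b)
  (w := toep b a (m a) * toep a a (m a) * toep a b (m a))) => //.
  by apply: Defs.idealMr; apply: idealMl.
rewrite -mab co_mul_toep ?(size_gt0 H) // eqxx addnK.
rewrite co_mul_toep ?(size_gt0 H) // eqxx addnK co_toep // !eqxx.
exact: oner_neq0.
Qed.

(** By induction along the chain, ranks in [I i] on the rows for [r] are at most the number of sizes
    in [l] with block identities in [I i]. At the end, 1 has rank [m a] on block [a]. *)
Lemma chain_support_bound (I : nat -> ideal A) (M : nat) (l : seq nat) :
  ideal_set (I M) 1 -> I 0 = [set 0]%classic :> set A ->
  (forall i, (i < M)%N -> (I i `<` I i.+1)%classic /\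
     heredity_ideal (quot_ideal (I i) (I i.+1))) ->
  (forall a, ev a = r -> m a \in l) ->
  forall a, ev a = r -> (m a <= size l)%N.
Proof.
move=> IM I0 chain lP.
pose full i k := `[< exists a, [/\ ev a = r, m a = k &
  ideal_set (I i) (toep a a (m a))] >].
have claim i : (i <= M)%N -> forall x a b p, ideal_set (I i) x -> ev a = r ->
    (count (full i) l < p)%N -> co x a b p = 0.
  elim: i => [|i IH] iM x a b p Ix ea hp.
    by move: Ix; rewrite I0 => ->; apply: (co0 H).
  have [[sub _] her] := chain i iM.
  have fullS k : full i k -> full i.+1 k.
    by move=> /asboolP[c [h1 h2 h3]]; apply/asboolP; exists c; split=> //; apply: sub.
  have [/hasP[k kl /andP[fS nf]]|/hasPn same] :=
      boolP (has (fun k => full i.+1 k && ~~ full i k) l).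
    have lt : (count (full i) l < count (full i.+1) l)%N.
      by apply: (count_sub_lt fullS kl).
    (* A new size raises the count, and the coordinate of [x] at [p] is that of [z * x] at [p.-1],
       which is positive because the count grew. *)
    have -> : p = p.-1.+1 by lia.
    have := IH (ltnW iM) _ a b p.-1 (heredity_nilp her Ix) ea.
    rewrite co_nilp_mul ea eqxx /=.
    have -> : (0 < p.-1)%N by lia.
    by apply; lia.
  (* With no new size, [eps * x] already lies in [I i] and has the same coordinates on these
     rows. *)
  have := IH (ltnW iM) (block_idem H (fun a => ev a == r) * x) a b p.
  rewrite co_idem_mul ea eqxx; apply=> //.
    apply: (heredity_same_support sub her) => // c ec Jc.
    have := same _ (lP c ec); rewrite negb_and negbK => /orP[/asboolPn[]|/asboolP].
      by exists c.
    by move=> [d [ed md Id]]; apply: full_ideal_same_size Id => //; rewrite ed.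
  apply: leq_ltn_trans hp; exact: sub_count.
move=> a ea; rewrite leqNgt; apply/negP => h.
have := claim M (leqnn M) 1 a a (m a) IM ea (leq_ltn_trans (count_size _ _) h).
by rewrite (co1 H) !eqxx; apply/eqP/oner_neq0.
Qed.

End Eigenvalue.
Lemma quasi_hereditary_size_bound r (l : seq nat) : quasi_hereditary A ->
  (forall a, ev a = r -> m a \in l) ->
  forall a, ev a = r -> (m a <= size l)%N.
Proof.
move=> [_ [M [I [I0 IM chain]]]]; apply: (chain_support_bound _ I0 chain).
by rewrite IM.
Qed.

End Necessity.

(** * Distinct block sizes in decreasing order, and the numerical criterion *)

Section SortedSizes.
Variable s : seq nat.
Hypothesis s_gt0 : forall x, x \in s -> (0 < x)%N.
Let l := sort geq (undup s).

Lemma mem_sort_undup x : (x \in l) = (x \in s).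
Proof. by rewrite mem_sort mem_undup. Qed.

Lemma leq_head_sort x : x \in s -> (x <= head 0 l)%N.
Proof.
have geqT : total geq by move=> x' y; apply: leq_total.
have geq_trans : transitive geq by move=> y x' z /= h1 h2; apply: leq_trans h1.
have := sort_sorted geqT (undup s); rewrite -mem_sort_undup -/l.
case: l => //= h t /(order_path_min geq_trans) /allP ht.
by rewrite inE => /predU1P[->//|/ht].
Qed.

Lemma sort_undup_sub : {subset l <= iota 1 (head 0 l)}.
Proof.
move=> x; rewrite mem_sort_undup => xs.
by rewrite mem_iota s_gt0 //= add1n ltnS leq_head_sort.
Qed.

Lemma size_sort_undup : (size l <= head 0 l)%N.
Proof.
rewrite -[leqRHS](size_iota 1); apply: uniq_leq_size sort_undup_sub.
by rewrite sort_uniq undup_uniq.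
Qed.

(** [l] is a duplicate-free part of the interval from 1 to its head; equal cardinality forces the
    whole interval. *)
Lemma head_eq_size_gapless x k :
  head 0%N l = size l -> x \in s -> (k < x)%N -> k.+1 \in s.
Proof.
move=> e xs kx; have ul : uniq l by rewrite sort_uniq undup_uniq.
have [|_ E] := uniq_min_size ul sort_undup_sub; first by rewrite size_iota e.
rewrite -mem_sort_undup E mem_iota /= add1n ltnS.
exact: leq_trans kx (leq_head_sort xs).
Qed.

Lemma head_eq_size_bound : s != [::] ->
  (forall x, x \in s -> (x <= size (undup s))%N) -> head 0%N l = size l.
Proof.
move=> s0 bound; apply/eqP; rewrite eqn_leq size_sort_undup andbT size_sort.
apply: bound; rewrite -mem_sort_undup.
case E: l => [|h t]; last by rewrite inE eqxx.
have := size_sort geq (undup s); rewrite -/l E => /esym/size0nil/undup_nil s_nil.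
by rewrite s_nil in s0.
Qed.

End SortedSizes.

(** The equality of head and size says that the block sizes of an eigenvalue fill an interval
    starting at 1, which is the absence of gaps. *)
Lemma jordan_quasi_hereditary (F : fieldType) n (c : 'M[F]_n.+1) bs :
  jordan_similar_to c bs ->
  quasi_hereditary (cent_alg c) <->
  forall lam, lam \in block_type bs -> head 0%N lam = size lam.
Proof.
move=> cbs; have [co H] := centralizer_coords cbs.
set m := fun i => _ in H; set ev := fun i => _ in H.
pose sizes r := [seq b.1 | b <- bs & b.2 == r].
have sizesP r k : reflect (exists2 i, ev i = r & m i = k) (k \in sizes r).
  apply: (iffP mapP) => [[b]|[i ei mi]].
    rewrite mem_filter => /andP[/eqP br /(tnthP (in_tuple bs))[i bi]] ->.
    by exists i; rewrite /ev /m -bi.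
  exists (tnth (in_tuple bs) i) => //.
  by rewrite mem_filter -[_ == r]/(ev i == r) ei eqxx; apply: (mem_tnth i (in_tuple bs)).
have sizes_gt0 r k : k \in sizes r -> (0 < k)%N.
  by move=> /sizesP[i _ <-]; apply: (size_gt0 H).
split=> [qh lam /mapP[r]|gapless].
  rewrite mem_undup => /mapP[b bbs br] ->; apply: head_eq_size_bound.
  - exact: sizes_gt0.
  - suff : b.1 \in sizes r by rewrite /sizes; case: map.
    by apply: map_f; rewrite mem_filter br eqxx.
  move=> _ /sizesP[i ei <-].
  apply: (quasi_hereditary_size_bound H (r := r)) => // a ea.
  by rewrite mem_undup; apply/sizesP; exists a.
apply: (gapless_quasi_hereditary H) => i k ki.
have : k.+1 \in sizes (ev i).
  have mi : m i \in sizes (ev i) by apply/sizesP; exists i.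
  apply: head_eq_size_gapless mi ki; first exact: sizes_gt0.
  apply/gapless/map_f; rewrite mem_undup; apply: map_f.
  exact: (mem_tnth i (in_tuple bs)).
by move=> /sizesP[a ea ma]; exists a.
Qed.

Theorem theorem1p1 :
  (forall (R : idomainType) (n : nat) (c : 'M[R]_n.+1),
     jordan_similar c -> cellular (cent_alg c)) /\
  (forall (F : fieldType) (n : nat) (c : 'M[F]_n.+1) (bt : seq (seq nat)),
     jordan_similar c -> has_block_type c bt ->
     (quasi_hereditary (cent_alg c) <->
      forall lam : seq nat, lam \in bt -> head 0%N lam = size lam)).
Proof.
split=> [R n c [bs /centralizer_coords[co H]]|F n c bt _ [bs cbs btE]].
  exact: block_coords_cellular H.
rewrite (jordan_quasi_hereditary cbs).
by split=> h lam lamP; apply: h; rewrite ?(perm_mem btE) // -(perm_mem btE).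
Qed.
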